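(* Let $\beta>0$, let $u$ be a positive eigenfunction of the Laplace-Beltrami operator on $\mathbb{H}^2$ with eigenvalue $\beta^2-\frac14$ and with boundary measure $\mu$, let $x_0\in\mathbb{R}$ and $L\in[0,\infty)$. If the function $(x,y)\mapsto y^{\beta-\frac12}u(x,y)$ admits radial limit $L$ along two distinct rays at $x_0$, then it has non-tangential limit $L$ at $x_0$.
   Context: $\mathbb{H}^2=\{(x,y):x\in\mathbb{R},\,y>0\}$ is the upper half-plane with metric $ds^2=y^{-2}(dx^2+dy^2)$; its Laplace-Beltrami operator is $\mathcal{L}=y^2(\partial_x^2+\partial_y^2)$, and $u$ is an eigenfunction with eigenvalue $c$ if $\mathcal{L}u=cu$. The boundary is identified with $\mathbb{R}$. The boundary measure of a positive eigenfunction $u$ with eigenvalue $\beta^2-\frac14$ is the unique positive measure $\mu$ on $\mathbb{R}$ such that, for some constant $C\ge0$, $u(x,y)=Cy^{\beta+\frac12}+c_\beta\int_{\mathbb{R}}\left(\frac{y}{y^2+(x-t)^2}\right)^{\beta+\frac12}d\mu(t)$, where $c_\beta>0$ is the constant with $c_\beta\int_{\mathbb{R}}(1+t^2)^{-\beta-\frac12}dt=1$. A ray at $x_0$ is a half-line $\{(x_0+\alpha y,y):y>0\}$ with $\alpha\in\mathbb{R}$; a function $F$ on $\mathbb{H}^2$ has radial limit $L$ along it if $\lim_{y\to0}F(x_0+\alpha y,y)=L$. $F$ has non-tangential limit $L$ at $x_0$ if for every $\alpha>0$, $F(x,y)\to L$ as $y\to0$ with $|x-x_0|<\alpha y$. 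*)

(* Defs.v *)
From HB Require Import structures.
From mathcomp Require Import all_boot all_order all_algebra.
From mathcomp Require Import all_classical all_reals all_analysis.
Set Implicit Arguments.
Unset Strict Implicit.
Unset Printing Implicit Defensive.
Import Order.TTheory GRing.Theory Num.Theory numFieldNormedType.Exports.
Local Open Scope classical_set_scope.
Local Open Scope ring_scope.

(* Functions on the upper half-plane are modelled as functions on R * R of
   which only the values on this open set are ever used. *)
Definition half_plane (R : realType) : set (R * R) := [set p | 0 < p.2].

(* All directional derivatives of order at most two exist and are continuous. *)
Definition C2_half_plane (R : realType) (u : R * R -> R) : Prop :=
  forall p, half_plane p ->
    {for p, continuous u} /\
    forall v : R * R,
      [/\ derivable u p v, {for p, continuous ('D_v u)} &
      forall w : R * R,
        derivable ('D_v u) p w /\ {for p, continuous ('D_w ('D_v u))}].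

Definition laplace_beltrami (R : realType) (u : R * R -> R) : R * R -> R :=
  fun p => p.2 ^+ 2 * ('D_(1, 0) ('D_(1, 0) u) p + 'D_(0, 1) ('D_(0, 1) u) p).

Definition eigenfunction (R : realType) (c : R) (u : R * R -> R) : Prop :=
  C2_half_plane u /\
  forall p, half_plane p -> laplace_beltrami u p = c * u p.

Definition positive_on_half_plane (R : realType) (u : R * R -> R) : Prop :=
  forall p, half_plane p -> 0 < u p.

(* The integral is positive and finite when 0 < beta. *)
Definition c_ (R : realType) (beta : R) : R :=
  (\int[@lebesgue_measure R]_t ((1 + t ^+ 2) `^ (- beta - 2^-1)))^-1.

(* The equation holds in the extended reals, so it contains the convergence of
   the integral; in particular mu is locally finite. *)
Definition boundary_measure (R : realType) (beta : R) (u : R * R -> R)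
    (mu : {measure set (measurableTypeR R) -> \bar R}) : Prop :=
  exists2 C : R, 0 <= C &
    forall x y : R, 0 < y ->
      ((u (x, y))%:E = (C * y `^ (beta + 2^-1))%:E +
        (c_ beta)%:E * \int[mu]_t
          ((y / (y ^+ 2 + (x - t) ^+ 2)) `^ (beta + 2^-1))%:E)%E.

Definition ray (R : realType) (x0 alpha : R) : set (R * R) :=
  [set p | exists2 y : R, 0 < y & p = (x0 + alpha * y, y)].

Definition radial_limit (R : realType) (F : R * R -> R) (x0 alpha L : R) :
    Prop :=
  F (x0 + alpha * y, y) @[y --> 0^'+] --> L.

Definition nontangential_limit (R : realType) (F : R * R -> R) (x0 L : R) :
    Prop :=
  forall alpha : R, 0 < alpha -> forall e : R, 0 < e ->
    \forall y \near 0^'+, forall x : R,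
      `|x - x0| < alpha * y -> `|F (x, y) - L| < e.

(* Main.v *)
Require Import Defs.
From HB Require Import structures.
From mathcomp Require Import all_boot all_order all_algebra.
From mathcomp Require Import all_classical all_reals all_analysis.
From mathcomp Require Import measurable_realfun ring lra.
Set Implicit Arguments.
Unset Strict Implicit.
Unset Printing Implicit Defensive.
Import Order.TTheory GRing.Theory Num.Theory numFieldNormedType.Exports.
Local Open Scope classical_set_scope.
Local Open Scope ring_scope.

(** Put [F (x, y) = y `^ (beta - 2^-1) * u (x, y)] and [s = beta + 2^-1].

    Between the two rays the limit [L] propagates by the maximum principle. Since
    [y `^ (2^-1 - beta)] is itself an eigenfunction, [u - L * y `^ (2^-1 - beta)]
    and its opposite are eigenfunctions; they are small, relatively to
    [y `^ (2^-1 - beta)], on the rays, and bounded between them by the Harnack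
    inequality [harnack]. Explicit supersolutions then show that they are small
    near the vertex, as in the Phragmen-Lindelof theorem ([no_touching],
    [sector_barrier], [sector_limit]).

    Outside this sector the limit propagates by analyticity. Up to a term that
    vanishes at the boundary, [F] at the point [x0 + r p] is the integral of
    [q_p `^ (- s)] against the image of [mu / r] under [(t - x0) / r], where
    [q_p t] is the squared distance from [p] to [t]. Let [p] be at height one in
    the interior of the sector and [p'] at height one anywhere. The convex
    combinations of [q_p] and [q_p'] are the [q] of the points of the geodesic
    from [p] to [p']; they can be written [q_p * (1 + h w)] with [0 <= h <= 1] and
    a bounded function [w]. For small [h] these points are in the sector, so that
    the integrals of [q_p `^ (- s) * (1 + h w) `^ (- s)] converge, to the same
    integrals against [L] times the Lebesgue measure. The binomial series in [h]
    yields the convergence for all powers of [w] in place of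
    [(1 + h w) `^ (- s)], and polynomial approximation yields it for
    [(1 + w) `^ (- s)], which corresponds to the point [p'] ([class_powR],
    [transfer_limit], [all_directions]).

    Radial limits along all rays combine into a non-tangential limit by the
    Harnack inequality and the compactness of the set of directions in a cone
    ([nontangential_of_radial]). *)

(** * Polynomial approximation *)

Lemma lipschitz_of_derive (R : realType) (f df : R -> R) (lo hi K : R) :
  (forall c, lo <= c <= hi -> is_derive c 1 f (df c)) ->
  (forall c, lo <= c <= hi -> `|df c| <= K) ->
  forall a b, lo <= a <= hi -> lo <= b <= hi ->
    `|f b - f a| <= K * `|b - a|.
Proof.
move=> fdf dfK.
suff H a b : lo <= a <= hi -> lo <= b <= hi -> a <= b ->
    `|f b - f a| <= K * `|b - a|.
  move=> a b ha hb; have [ab|/ltW ba] := leP a b; first exact: H.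
  by rewrite distrC (distrC b); exact: H.
move=> /andP[la ah] /andP[lb bh] ab.
have dcab c : a <= c -> c <= b -> lo <= c <= hi.
  by move=> ac cb; rewrite (le_trans la ac) (le_trans cb bh).
have [c||c] := @MVT_segment R f df a b ab.
- rewrite in_itv/= => /andP[/ltW ac /ltW cb]; exact/fdf/dcab.
- apply: continuous_in_subspaceT => c; rewrite inE/= in_itv/= => /andP[ac cb].
  have := fdf c (dcab _ ac cb) => fc.
  exact/differentiable_continuous/derivable1_diffP/ex_derive.
- rewrite in_itv/= => /andP[ac cb] ->; rewrite normrM ler_wpM2r//.
  exact/dfK/dcab.
Qed.

(** The generalised binomial coefficient of [- s] over [n], computed through the
    recursion that differentiation imposes. *)
Fixpoint binom_coef (R : realType) (s : R) (n : nat) : R :=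
  if n is m.+1 then - s * binom_coef (s + 1) m / m.+1%:R else 1.

Lemma binom_coef_neq0 (R : realType) (s : R) n : 0 < s -> binom_coef s n != 0.
Proof.
elim: n s => [s _|n IH s s0] /=; first exact: oner_neq0.
rewrite mulf_neq0 ?invr_eq0 ?pnatr_eq0// mulf_neq0 ?oppr_eq0 ?(gt_eqF s0)//.
by rewrite IH ?addr_gt0.
Qed.

Definition binom_poly (R : realType) (s : R) (n : nat) : {poly R} :=
  \poly_(j < n) binom_coef s j.

Lemma deriv_binom_poly (R : realType) (s : R) n :
  (binom_poly s n.+1)^`() = - s *: binom_poly (s + 1) n.
Proof.
apply/polyP => i; rewrite coef_deriv coefZ !coef_poly ltnS.
case: ifP => [|_]; last by rewrite mul0rn mulr0.
by move=> _ /=; rewrite -[LHS]mulr_natr divfK ?pnatr_eq0.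
Qed.

Lemma is_derive_powRD1 (R : realType) (s x : R) : -1 < x ->
  is_derive x 1 (fun z => (1 + z) `^ (- s)) (- s * (1 + x) `^ (- (s + 1))).
Proof.
move=> x1; have x0 : 0 < 1 + x by rewrite -ltrBlDl sub0r.
have h1 : is_derive (1 + x) 1 (fun z : R => z `^ (- s))
    (- s * (1 + x) `^ (- s - 1)) by exact: is_derive1_powR.
have h2 : is_derive x 1 (fun z : R => 1 + z) (0 + 1).
  by apply: is_deriveD.
have := @is_derive1_comp R _ _ x _ _ h1 h2.
by rewrite add0r /GRing.scale/= mulr1 opprD.
Qed.

Lemma powRD1_le (R : realType) (s x : R) : 0 < s -> `|x| <= 2^-1 ->
  `|(1 + x) `^ (- s)| <= 2^-1 `^ (- s).
Proof.
move=> s0; rewrite ler_norml => /andP[x1 x2].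
have x3 : 2^-1 <= 1 + x by lra.
have x4 : 0 < 1 + x by apply: lt_le_trans x3; rewrite invr_gt0.
rewrite ger0_norm ?powR_ge0// !powRN lef_pV2 ?posrE ?powR_gt0//.
by rewrite ge0_ler_powR ?nnegrE// ltW.
Qed.

(** Taylor's formula with an unspecified constant. The derivative of the error
    for [(s, n.+1)] is [- s] times the error for [(s + 1, n)], so that
    integrating once raises the order by one. *)
Lemma binom_poly_approx (R : realType) (n : nat) (s : R) : 0 < s ->
  exists2 K : R, 0 <= K & forall x, `|x| <= 2^-1 ->
    `|(1 + x) `^ (- s) - (binom_poly s n).[x]| <= K * `|x| ^+ n.
Proof.
elim: n s => [s s0|n IH s s0].
  exists (2^-1 `^ (- s)); first exact: powR_ge0.
  move=> x hx; rewrite expr0 mulr1 (_ : binom_poly s 0 = 0).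
    by rewrite horner0 subr0; exact: powRD1_le.
  by apply/polyP => i; rewrite coef_poly coef0.
have s10 : 0 < s + 1 by rewrite addr_gt0.
have [K K0 HK] := IH _ s10.
exists (s * K) => [|x hx]; first by rewrite mulr_ge0// ltW.
pose f z := (1 + z) `^ (- s) - (binom_poly s n.+1).[z].
pose df z := - s * (1 + z) `^ (- (s + 1)) - (- s *: binom_poly (s + 1) n).[z].
have fdf c : - `|x| <= c <= `|x| -> is_derive c 1 f (df c).
  move=> /andP[c1 c2]; rewrite /df -deriv_binom_poly.
  have c3 : -1 < c by apply: lt_le_trans c1; lra.
  by apply: is_deriveB; exact: is_derive_powRD1.
have dfK c : - `|x| <= c <= `|x| -> `|df c| <= s * K * `|x| ^+ n.
  rewrite -ler_norml => hc.
  rewrite /df hornerZ -mulrBr normrM normrN (gtr0_norm s0) -mulrA.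
  rewrite ler_wpM2l ?(ltW s0)//; apply: le_trans (HK _ (le_trans hc hx)) _.
  by rewrite ler_wpM2l// lerXn2r ?nnegrE.
have f0 : f 0 = 0.
  rewrite /f addr0 powR1 horner_coef0 coef_poly/=; exact: subrr.
have := lipschitz_of_derive fdf dfK (a := 0) (b := x).
rewrite f0 !subr0 exprSr mulrA; apply; last by rewrite -ler_norml.
by rewrite oppr_le0 normr_ge0.
Qed.

(** With [g k = f (k / n)] this is the Bernstein polynomial of [f]: the
    expectation of [g] at the number of successes in [n] independent trials
    with success probability ['X], computed by conditioning on one trial. *)
Fixpoint bernstein (R : realType) (n : nat) (g : nat -> R) : {poly R} :=
  if n is m.+1 then (1 - 'X) * bernstein m g + 'X * bernstein m (g \o S)
  else (g 0%N)%:P.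

(** For a binomial variable [k], the mean of [(k - y) ^+ 2] is its variance
    [n x (1 - x)] plus [(n x - y) ^+ 2]. *)
Lemma bernstein_le (R : realType) (n : nat) (g : nat -> R) (x y c a : R) :
  0 <= x <= 1 ->
  (forall k, (k <= n)%N -> g k <= c + a * (k%:R - y) ^+ 2) ->
  (bernstein n g).[x] <=
    c + a * (n%:R * (x * (1 - x)) + (n%:R * x - y) ^+ 2).
Proof.
move=> /andP[x0 x1]; elim: n g y => [|n IH] g y hg /=.
  by rewrite hornerC mul0r add0r mul0r hg.
rewrite hornerD !hornerM hornerD hornerN hornerX -polyC1 hornerC.
have h1 := IH g y (fun k kn => hg k (leqW kn)).
have h2 : (bernstein n (g \o S)).[x] <=
    c + a * (n%:R * (x * (1 - x)) + (n%:R * x - (y - 1)) ^+ 2).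
  apply: IH => k kn /=; apply: (le_trans (hg k.+1 kn)).
  by rewrite -natr1 opprB addrA.
have x1' : 0 <= 1 - x by rewrite subr_ge0.
apply: (le_trans (lerD (ler_wpM2l x1' h1) (ler_wpM2l x0 h2))).
rewrite -[n.+1%:R]natr1 le_eqVlt; apply/orP; left; apply/eqP; ring.
Qed.

Lemma bernsteinN (R : realType) (n : nat) (g : nat -> R) :
  bernstein n (fun k => - g k) = - bernstein n g.
Proof.
elim: n g => [|n IH] g /=; first by rewrite polyCN.
by rewrite (IH (g \o S)) IH; ring.
Qed.

(** Weierstrass approximation, in the Lipschitz case: the standard deviation of
    [k / n] tends to [0]. *)
Lemma bernstein_approx (R : realType) (f : R -> R) (K e : R) : 0 < e ->
  (forall x y, 0 <= x <= 1 -> 0 <= y <= 1 -> `|f x - f y| <= K * `|x - y|) ->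
  exists p : {poly R}, forall x, 0 <= x <= 1 -> `|f x - p.[x]| <= e.
Proof.
move=> e0 fK.
have K0 : 0 <= K.
  have := fK 1 0; rewrite ?ler01 ?lexx => /(_ isT isT).
  by rewrite subr0 normr1 mulr1; exact: le_trans.
have [eta eta0 Keta] : exists2 eta, 0 < eta & K * eta <= e / 2.
  exists (e / (2 * (K + 1))).
    by rewrite divr_gt0// mulr_gt0// ltr_wpDl.
  by rewrite mulrA ler_pdivrMr ?mulr_gt0 ?ltr_wpDl//; nra.
pose n := (Num.bound (2 * K / (eta * e))).+1.
have n0 : 0 < n%:R :> R by rewrite ltr0n.
have nK : K / (eta * n%:R) <= e / 2.
  have : 2 * K / (eta * e) < n%:R.
    apply: (lt_le_trans (archi_boundP _)); last by rewrite ler_nat.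
    by apply: divr_ge0; apply: mulr_ge0 => //; exact: ltW.
  rewrite ltr_pdivrMr ?mulr_gt0// => /ltW h.
  rewrite ler_pdivrMr ?mulr_gt0//; lra.
exists (bernstein n (fun k => f (k%:R / n%:R))) => x x01.
(* [`|d| <= eta + d ^+ 2 / eta] makes the Lipschitz bound quadratic in [k] *)
have quad k : (k <= n)%N -> `|f (k%:R / n%:R) - f x| <=
    K * eta + K / (eta * n%:R ^+ 2) * (k%:R - n%:R * x) ^+ 2.
  move=> kn; apply: (le_trans (fK _ _ _ x01)).
    by rewrite divr_ge0//= ler_pdivrMr// mul1r ler_nat.
  set d := k%:R / n%:R - x.
  have -> : K / (eta * n%:R ^+ 2) * (k%:R - n%:R * x) ^+ 2 =
      K * (`|d| ^+ 2 / eta).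
    rewrite /d real_normK ?num_real//; field.
    by rewrite !gt_eqF.
  rewrite -mulrDr ler_wpM2l//.
  rewrite -(ler_pM2r eta0) mulrDl divfK ?gt_eqF//.
  nra.
pose Q := K * eta + K / (eta * n%:R ^+ 2) *
  (n%:R * (x * (1 - x)) + (n%:R * x - n%:R * x) ^+ 2).
have bound : `|f x - (bernstein n (fun k => f (k%:R / n%:R))).[x]| <= Q.
  rewrite ler_distlC; apply/andP; split.
    have : (bernstein n (fun k => - f (k%:R / n%:R))).[x] <= - f x + Q.
      rewrite /Q addrA; apply: bernstein_le => // k kn.
      have := quad k kn; rewrite ler_distl => /andP[]; lra.
    by rewrite bernsteinN hornerN; lra.
  rewrite /Q addrA; apply: bernstein_le => // k kn.
  have := quad k kn; rewrite ler_distl => /andP[]; lra.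
apply: (le_trans bound); rewrite /Q subrr expr0n/= addr0.
have -> : K / (eta * n%:R ^+ 2) * (n%:R * (x * (1 - x))) =
    K / (eta * n%:R) * (x * (1 - x)).
  by field; rewrite !gt_eqF.
have : K / (eta * n%:R) * (x * (1 - x)) <= K / (eta * n%:R).
  rewrite ler_piMr// ?divr_ge0// ?mulr_ge0 ?ltW//.
  by case/andP: x01 => *; nra.
lra.
Qed.

(** * Classes of functions closed under uniform limits *)

Lemma norm_le_itv (R : realType) (lo hi w : R) :
  lo <= w <= hi -> `|w| <= `|lo| + `|hi|.
Proof.
move=> /andP[w1 w2]; rewrite ler_norml.
have := ler_norm lo; have := ler_norm (- lo); rewrite normrN.
have := ler_norm hi; have := ler_norm (- hi); rewrite normrN => *.
by apply/andP; split; lra.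
Qed.

Lemma lipschitz_powRD1 (R : realType) (s lo hi : R) : 0 < s -> -1 < lo ->
  forall x y, lo <= x <= hi -> lo <= y <= hi ->
  `|(1 + x) `^ (- s) - (1 + y) `^ (- s)| <=
    s * (1 + lo) `^ (- (s + 1)) * `|x - y|.
Proof.
move=> s0 lo1 x y hx hy.
apply: (lipschitz_of_derive (lo := lo) (hi := hi)
  (f := fun z => (1 + z) `^ (- s))
  (df := fun z => - s * (1 + z) `^ (- (s + 1)))) => // c /andP[c1 c2].
  by apply: is_derive_powRD1; exact: lt_le_trans c1.
have lo0 : 0 < 1 + lo by rewrite -ltrBlDl sub0r.
have c0 : 0 < 1 + c by rewrite (lt_le_trans lo0)// lerD2l.
rewrite normrM normrN (gtr0_norm s0) ger0_norm ?powR_ge0// ler_wpM2l ?(ltW s0)//.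
rewrite !powRN lef_pV2 ?posrE ?powR_gt0//.
by apply: ge0_ler_powR; rewrite ?nnegrE ?(ltW lo0) ?(ltW c0) ?lerD2l// addr_ge0// ltW.
Qed.

(** The properties of the class of all [f] for which integrals of [f (w _)]
    converge to a prescribed limit, when [w] takes its values in [[lo, hi]]. *)
Record closed_linear_class (R : realType) (lo hi : R)
    (G : (R -> R) -> Prop) : Prop := ClosedLinearClass {
  class_add : forall f g, G f -> G g -> G (fun w => f w + g w);
  class_scale : forall k f, G f -> G (fun w => k * f w);
  class_closed : forall f : R -> R, measurable_fun setT f ->
    (forall e : R, 0 < e -> exists2 g, G g &
      forall w, lo <= w <= hi -> `|f w - g w| <= e) -> G f }.

Lemma class_sum (R : realType) (lo hi : R) (G : (R -> R) -> Prop) (n : nat)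
    (c : nat -> R) (F : nat -> R -> R) : closed_linear_class lo hi G ->
  (exists f, G f) -> (forall j, (j < n)%N -> G (F j)) ->
  G (fun w => \sum_(j < n) c j * F j w).
Proof.
move=> hG [f Gf]; elim: n => [_|n IH hF].
  rewrite (_ : (fun _ => _) = fun w => 0 * f w); first exact: class_scale hG _ _ Gf.
  by apply/funext => w; rewrite big_ord0 mul0r.
rewrite (_ : (fun _ => _) =
  fun w => (\sum_(j < n) c j * F j w) + c n * F n w); last first.
  by apply/funext => w; rewrite big_ord_recr.
apply: (class_add hG); first by apply: IH => j jn; exact/hF/leqW.
by apply: (class_scale hG); exact: hF.
Qed.

(** The binomial series [(1 + d w) ^ (- s) = \sum_j c_j d^j w^j] has no zero
    coefficient. Once the powers below [n] are in the class, subtracting their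
    terms and dividing by [c_n d^n] leaves [w ^+ n + O(d)]. *)
Lemma class_expr (R : realType) (lo hi s d0 : R) (G : (R -> R) -> Prop) :
  0 < s -> 0 < d0 -> closed_linear_class lo hi G ->
  (forall d, 0 < d -> d < d0 -> G (fun w => (1 + d * w) `^ (- s))) ->
  forall n, G (fun w => w ^+ n).
Proof.
move=> s0 d00 hG Gpow n; elim/ltn_ind: n => n IH.
have G0 : exists f, G f.
  by exists (fun w => (1 + d0 / 2 * w) `^ (- s)); apply: Gpow; lra.
have [K K0 HK] := binom_poly_approx n.+1 s0.
have cn := binom_coef_neq0 n s0.
set c := binom_coef s n in cn.
apply: (class_closed hG) => [|e e0]; first exact: exprn_measurable.
pose M := `|lo| + `|hi| + 1.
have M0 : 0 < M by rewrite ltr_wpDl// addr_ge0.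
have wM w : lo <= w <= hi -> `|w| <= M.
  by move=> /norm_le_itv /le_trans; apply; rewrite lerDl.
have q0 : 0 < K * M ^+ n.+1 + 1 by rewrite ltr_wpDl// mulr_ge0// exprn_ge0// ltW.
(* the bound [e] is reached as soon as [K d M^(n+1) <= e |c_n|] *)
have [d [dp dd0 dM dK]] : exists d, [/\ 0 < d, d < d0, d * M <= 2^-1 &
    K * d * M ^+ n.+1 <= e * `|c|].
  exists (Num.min (d0 / 2) (Num.min (2^-1 / M) (e * `|c| / (K * M ^+ n.+1 + 1)))).
  split.
  - rewrite !lt_min !divr_gt0 ?mulr_gt0 ?normr_gt0//.
  - by rewrite gt_min; apply/orP; left; lra.
  - by rewrite -ler_pdivlMr// !ge_min lexx orbT.
  - rewrite mulrAC mulrC.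
    set m := Num.min _ _.
    have m0 : m * (K * M ^+ n.+1 + 1) <= e * `|c|.
      by rewrite -ler_pdivlMr// !ge_min lexx !orbT.
    have mge0 : 0 <= m by rewrite !le_min !divr_ge0 ?mulr_ge0// ltW.
    by apply: le_trans m0; rewrite ler_wpM2l// lerDl.
have cd : c * d ^+ n != 0 by rewrite mulf_neq0// expf_neq0// gt_eqF.
exists (fun w => (c * d ^+ n)^-1 * ((1 + d * w) `^ (- s) +
    (-1) * \sum_(j < n) (binom_coef s j * d ^+ j) * w ^+ j)).
  apply: (class_scale hG); apply: (class_add hG); first exact: Gpow.
  apply: (class_scale hG).
  exact: (class_sum (fun j => binom_coef s j * d ^+ j) hG G0 IH).
move=> w /wM hw.
have hdw : `|d * w| <= 2^-1.
  by rewrite normrM gtr0_norm// (le_trans _ dM)// ler_wpM2l// ltW.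
have := HK _ hdw.
rewrite horner_poly big_ord_recr/= -/c.
under eq_bigr do rewrite exprMn mulrA.
rewrite exprMn mulrA mulN1r; set S := \sum_(j < n) _; set P := _ `^ _ => hP.
have -> : w ^+ n - (c * d ^+ n)^-1 * (P - S) =
    - (c * d ^+ n)^-1 * (P - (S + c * d ^+ n * w ^+ n)).
  by move: (c * d ^+ n) cd => D D0; field.
rewrite normrM normrN normfV ler_pdivrMl ?normr_gt0//.
apply: (le_trans hP); rewrite !normrM (gtr0_norm dp) normrX (gtr0_norm dp).
rewrite exprMn.
have wn : `|w| ^+ n.+1 <= M ^+ n.+1 by rewrite lerXn2r ?nnegrE// ltW.
rewrite [X in _ <= X](_ : _ = d ^+ n * (e * `|c|)); last by ring.
apply: (@le_trans _ _ (d ^+ n * (K * d * M ^+ n.+1))); last first.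
  by rewrite ler_wpM2l// exprn_ge0// ltW.
rewrite exprSr [X in X <= _](_ : _ = d ^+ n * (K * d * `|w| ^+ n.+1)); last by ring.
by rewrite !ler_wpM2l// ?exprn_ge0 ?mulr_ge0// ltW.
Qed.

Lemma class_poly (R : realType) (lo hi : R) (G : (R -> R) -> Prop) :
  closed_linear_class lo hi G -> (forall n, G (fun w => w ^+ n)) ->
  forall p : {poly R}, G (horner p).
Proof.
move=> hG Gn p.
rewrite (_ : horner p = fun w => \sum_(j < size p) p`_j * w ^+ j); last first.
  by apply/funext => w; rewrite horner_coef.
have G0 : exists f, G f by exists (fun w => w ^+ 0).
exact: (class_sum (fun j => p`_j) hG G0 (fun j _ => Gn j)).
Qed.

(** Analytic continuation in [d] from small positive values to [d = 1], where the
    binomial series need not converge: all polynomials are in the class, and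
    they approximate [(1 + w) ^ (- s)] uniformly on [[lo, hi]]. *)
Lemma class_powR (R : realType) (lo hi s d0 : R) (G : (R -> R) -> Prop) :
  0 < s -> 0 < d0 -> -1 < lo -> lo < hi -> closed_linear_class lo hi G ->
  (forall d, 0 < d -> d < d0 -> G (fun w => (1 + d * w) `^ (- s))) ->
  G (fun w => (1 + w) `^ (- s)).
Proof.
move=> s0 d00 lo1 lohi hG Gpow.
have Gp := class_poly hG (class_expr s0 d00 hG Gpow).
have D0 : 0 < hi - lo by rewrite subr_gt0.
apply: (class_closed hG) => [|e e0].
  apply: (@measurableT_comp _ _ _ _ _ _ (fun z : R => z `^ (- s))) => //.
  exact: measurable_funD.
pose K := s * (1 + lo) `^ (- (s + 1)).
pose f z := (1 + (lo + (hi - lo) * z)) `^ (- s).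
have fK x y : 0 <= x <= 1 -> 0 <= y <= 1 ->
    `|f x - f y| <= K * (hi - lo) * `|x - y|.
  move=> hx hy; have aff z : 0 <= z <= 1 -> lo <= lo + (hi - lo) * z <= hi.
    by move=> /andP[z0 z1]; apply/andP; split; nra.
  apply: (le_trans (lipschitz_powRD1 s0 lo1 (aff _ hx) (aff _ hy))).
  rewrite (_ : _ - (_ + _) = (hi - lo) * (x - y)); last by ring.
  by rewrite normrM (gtr0_norm D0) mulrA.
have [p hp] := bernstein_approx e0 fK.
exists (horner (p \Po ((hi - lo)^-1 *: ('X - lo%:P)))); first exact: Gp.
move=> w /andP[w1 w2]; rewrite horner_comp hornerZ hornerD hornerN hornerX hornerC.
have := hp ((hi - lo)^-1 * (w - lo)).
rewrite /f mulVKf ?gt_eqF// (addrC lo) subrK; apply.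
rewrite ler_pdivrMl// mulr1 lerD2r w2 andbT.
by rewrite mulr_ge0 ?subr_ge0 ?invr_ge0// ltW.
Qed.

(** * Limits of weighted integrals *)

Lemma integrable_scale d (T : measurableType d) (R : realType)
    (mu : {measure set T -> \bar R}) (k : R) (f : T -> R) :
  mu.-integrable setT (EFin \o f) ->
  mu.-integrable setT (EFin \o (fun t => k * f t)).
Proof. by move=> /(integrableZl measurableT k). Qed.

(** What is needed of [b] and [w] for [f] to have an integral of [b t * f (w t)]
    that is bounded in terms of the values of [f] on [[lo, hi]]. *)
Record bounded_weight d (T : measurableType d) (R : realType)
    (mu : {measure set T -> \bar R}) (lo hi : R) (b w : T -> R) : Prop :=
  BoundedWeight {
  weight_ge0 : forall t, 0 <= b t;
  weight_int : mu.-integrable setT (EFin \o b);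
  weight_meas : measurable_fun setT w;
  weight_itv : forall t, lo <= w t <= hi }.

Lemma weight_integrable d (T : measurableType d) (R : realType)
    (mu : {measure set T -> \bar R}) (lo hi K : R) (b w : T -> R) (f : R -> R) :
  bounded_weight mu lo hi b w -> measurable_fun setT f ->
  (forall v, lo <= v <= hi -> `|f v| <= K) ->
  mu.-integrable setT (EFin \o (fun t => b t * f (w t))).
Proof.
move=> hb mf fK.
apply: (@le_integrable _ _ _ mu setT measurableT _ (EFin \o (fun t => K * b t))).
- apply/measurable_EFinP; apply: measurable_funM.
    by apply/measurable_EFinP; exact: measurable_int (weight_int hb).
  by apply: measurableT_comp => //; exact: weight_meas hb.
- move=> t _ /=; rewrite lee_fin !normrM mulrC ler_wpM2r//.
  by apply: le_trans (ler_norm K); exact/fK/(weight_itv hb).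
- exact: integrable_scale (weight_int hb).
Qed.

Lemma weight_le d (T : measurableType d) (R : realType)
    (mu : {measure set T -> \bar R}) (lo hi K L e : R) (b w : T -> R)
    (f g : R -> R) :
  bounded_weight mu lo hi b w -> measurable_fun setT f -> measurable_fun setT g ->
  (forall v, lo <= v <= hi -> `|f v| <= K) ->
  (forall v, lo <= v <= hi -> `|g v| <= L) ->
  (forall v, lo <= v <= hi -> `|f v - g v| <= e) ->
  `|\int[mu]_t (b t * f (w t)) - \int[mu]_t (b t * g (w t))| <=
    e * \int[mu]_t (b t).
Proof.
move=> hb mf mg fK gL fg.
have If := weight_integrable hb mf fK; have Ig := weight_integrable hb mg gL.
have mfg : measurable_fun setT (fun v => f v - g v) by exact: measurable_funB.
have Ifg := weight_integrable hb mfg fg.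
have mfg' : measurable_fun setT (fun v => `|f v - g v|).
  exact: measurableT_comp.
have Ifg' : mu.-integrable setT (EFin \o (fun t => b t * `|f (w t) - g (w t)|)).
  by apply: (weight_integrable (K := e) hb mfg') => v /fg; rewrite normr_id.
rewrite -RintegralB//.
under eq_Rintegral do rewrite -mulrBr.
apply: (le_trans (le_normr_Rintegral measurableT Ifg)).
under eq_Rintegral do rewrite normrM (ger0_norm (weight_ge0 hb _)).
rewrite -RintegralZl//; last exact: weight_int hb.
apply: le_Rintegral => //.
  exact: integrable_scale (weight_int hb).
move=> t _; rewrite mulrC ler_wpM2r ?(weight_ge0 hb)//.
exact/fg/(weight_itv hb).
Qed.

(** Closedness is where the total masses matter: since they converge, they are
    eventually bounded, so that a uniform approximation of [f] is an
    approximation of all the integrals at once. *)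
Lemma closed_linear_class_lim (R : realType) d (T : measurableType d)
    (mu : {measure set T -> \bar R}) d' (T' : measurableType d')
    (mu' : {measure set T' -> \bar R}) (I : Type) (F : set_system I)
    {FF : ProperFilter F} (lo hi : R) (b w : I -> T -> R) (b' w' : T' -> R) :
  (\forall i \near F, bounded_weight mu lo hi (b i) (w i)) ->
  bounded_weight mu' lo hi b' w' ->
  \int[mu]_t (b i t) @[i --> F] --> \int[mu']_t (b' t) ->
  closed_linear_class lo hi (fun f : R -> R => [/\ measurable_fun setT f,
    exists K : R, forall v, lo <= v <= hi -> `|f v| <= K &
    \int[mu]_t (b i t * f (w i t)) @[i --> F] -->
      \int[mu']_t (b' t * f (w' t))]).
Proof.
move=> hb hb' hcvg; split.
- move=> f g [mf [K fK] cf] [mg [L gL] cg]; split.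
  + exact: measurable_funD.
  + by exists (K + L) => v hv; rewrite (le_trans (ler_normD _ _))// lerD ?fK ?gL.
  + under eq_Rintegral do rewrite mulrDr.
    rewrite RintegralD//; [|exact: weight_integrable hb' mf fK
      |exact: weight_integrable hb' mg gL].
    apply: cvg_trans (cvgD cf cg); apply: near_eq_cvg.
    near=> i => /=; under [in RHS]eq_Rintegral do rewrite mulrDr.
    have hi' : bounded_weight mu lo hi (b i) (w i) by near: i.
    by rewrite RintegralD//; [exact: weight_integrable hi' mf fK
      |exact: weight_integrable hi' mg gL].
- move=> k f [mf [K fK] cf]; split.
  + exact: measurable_funM.
  + by exists (`|k| * K) => v hv; rewrite normrM ler_wpM2l// fK.
  + under eq_Rintegral do rewrite mulrCA.
    rewrite RintegralZl//; last exact: weight_integrable hb' mf fK.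
    apply: cvg_trans (cvgM (cvg_cst k) cf); apply: near_eq_cvg.
    near=> i => /=; under [in RHS]eq_Rintegral do rewrite mulrCA.
    have hi' : bounded_weight mu lo hi (b i) (w i) by near: i.
    by rewrite RintegralZl//; exact: weight_integrable hi' mf fK.
- move=> f mf appr.
  have [g1 [mg1 [K1 g1K] _] fg1] := appr 1 ltr01.
  have fK v : lo <= v <= hi -> `|f v| <= 1 + K1.
    move=> hv; rewrite -[f v](subrK (g1 v)) (le_trans (ler_normD _ _))//.
    by rewrite lerD ?fg1 ?g1K.
  split => //; first by exists (1 + K1).
  set J := \int[mu']_t b' t in hcvg.
  have J0 : 0 <= J by apply: Rintegral_ge0 => t _; exact: weight_ge0 hb' _.
  apply/cvgrPdist_le => e e0.
  pose q := e / (4 * (J + 1)).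
  have q0 : 0 < q by rewrite divr_gt0 ?mulr_gt0// ltr_wpDl.
  have qJ : q * (J + 1) = e / 4.
    by rewrite /q; field; rewrite gt_eqF// ltr_wpDl.
  have [g [mg [K gK] cg] fg] := appr q q0.
  near=> i.
  have hi' : bounded_weight mu lo hi (b i) (w i) by near: i.
  have c1 : `|\int[mu']_t (b' t * g (w' t)) - \int[mu]_t (b i t * g (w i t))| <= e / 4.
    by near: i; move/cvgrPdist_le : cg; apply; rewrite divr_gt0.
  have c2 : `|J - \int[mu]_t (b i t)| <= 1.
    by near: i; move/cvgrPdist_le : hcvg; apply.
  have c3 := weight_le hi' mf mg fK gK fg.
  have c4 := weight_le hb' mf mg fK gK fg.
  rewrite -/J in c4.
  have c5 : q * \int[mu]_t (b i t) <= q * (J + 1).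
    rewrite ler_wpM2l ?(ltW q0)//; move: c2; rewrite ler_distlC => /andP[]; lra.
  have c6 : q * J <= q * (J + 1) by rewrite ler_wpM2l ?(ltW q0)// lerDl.
  move: (\int[mu]_t (b i t * f (w i t))) (\int[mu]_t (b i t * g (w i t)))
    c1 c3 => u1 u2 c1 c3.
  move: (\int[mu']_t (b' t * f (w' t))) (\int[mu']_t (b' t * g (w' t)))
    c1 c4 => v1 v2 c1 c4.
  rewrite qJ in c5 c6.
  have := le_trans c3 c5; have := le_trans c4 c6; move: c1.
  rewrite !ler_norml => /andP[? ?] /andP[? ?] /andP[? ?]; apply/andP; split; lra.
Unshelve. all: by end_near. Qed.

(** The value [h = 0] gives the convergence of the total masses; the values
    [0 < h < d0] generate, through [class_powR], the value [h = 1]. *)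
Lemma transfer_limit (R : realType) d (T : measurableType d)
    (mu : {measure set T -> \bar R}) d' (T' : measurableType d')
    (mu' : {measure set T' -> \bar R}) (I : Type) (F : set_system I)
    {FF : ProperFilter F} (lo hi s d0 : R) (b w : I -> T -> R)
    (b' w' : T' -> R) :
  0 < s -> 0 < d0 -> -1 < lo -> lo < hi -> 
  (\forall i \near F, bounded_weight mu lo hi (b i) (w i)) ->
  bounded_weight mu' lo hi b' w' ->
  (forall h : R, 0 <= h -> h < d0 ->
    \int[mu]_t (b i t * (1 + h * w i t) `^ (- s)) @[i --> F] -->
    \int[mu']_t (b' t * (1 + h * w' t) `^ (- s))) ->
  \int[mu]_t (b i t * (1 + w i t) `^ (- s)) @[i --> F] -->
    \int[mu']_t (b' t * (1 + w' t) `^ (- s)).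
Proof.
move=> s0 d00 lo1 lohi hb hb' hd.
have mpow h : measurable_fun setT (fun v : R => (1 + h * v) `^ (- s)).
  apply: (@measurableT_comp _ _ _ _ _ _ (fun z : R => z `^ (- s))) => //.
  by apply: measurable_funD => //; exact: measurable_funM.
have h0 : \int[mu]_t (b i t) @[i --> F] --> \int[mu']_t (b' t).
  have := hd 0 (lexx _) d00.
  under eq_Rintegral do rewrite mul0r addr0 powR1 mulr1.
  apply: cvg_trans; apply: near_eq_cvg; near=> i.
  by apply: eq_Rintegral => t _; rewrite mul0r addr0 powR1 mulr1.
have hG := closed_linear_class_lim hb hb' h0.
pose M := `|lo| + `|hi|.
have M0 : 0 <= M by rewrite addr_ge0.
have wM v : lo <= v <= hi -> `|v| <= M by exact: norm_le_itv.
have d10 : 0 < Num.min d0 (2 * (M + 1))^-1.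
  by rewrite lt_min d00 invr_gt0 mulr_gt0// ltr_wpDl.
have [] // := @class_powR _ _ _ s _ _ s0 d10 lo1 lohi (hG FF).
move=> h dp; rewrite lt_min => /andP[dd0 dM]; split => //.
- exists (2^-1 `^ (- s)) => v /wM vM.
  have dM2 : h * M <= 2^-1.
    have : h * (2 * (M + 1)) <= 1.
      by rewrite -ler_pdivlMr ?mulr_gt0 ?ltr_wpDl// div1r ltW.
    nra.
  apply: powRD1_le => //.
  by rewrite normrM (gtr0_norm dp) (le_trans _ dM2)// ler_wpM2l// ltW.
- by apply: hd => //; exact: ltW.
Unshelve. all: by end_near. Qed.

(** * Second derivatives at a maximum *)

(** If [l > 0] then [g] is increasing through [a], hence positive on the right of
    [a] or negative on its left, and [f] increases away from [a] on that side. *)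
Lemma second_derivative_le0 (R : realType) (f g : R -> R) (a l : R) :
  (\forall s \near a, is_derive (s : R) 1 f (g s)) -> is_derive a 1 g l ->
  (\forall s \near a, f s <= f a) -> l <= 0.
Proof.
move=> hf [gd gl] hmax; rewrite leNgt; apply/negP => l0.
have hq : \forall h \near 0^', 0 < h^-1 * (g (h + a) - g a).
  have := gd; rewrite /derivable => /cvg_ex[l' hl'].
  have ll' : l' = l.
    by rewrite -gl; apply/esym; exact: cvg_lim hl'.
  rewrite ll' in hl'.
  have hg := cvgr_gt l hl' _ l0.
  near=> h.
  have : 0 < h^-1 *: ((g \o shift a) (h%:A) - g a) by near: h; exact: hg.
  by rewrite /GRing.scale/= mulr1.
have [e e0 he] : exists2 e : R, 0 < e & forall s : R, `|s - a| < e ->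
    [/\ is_derive (s : R) 1 f (g s), f s <= f a &
        s != a -> 0 < (s - a)^-1 * (g s - g a)].
  have hq' : \forall s \near a, s != a -> 0 < (s - a)^-1 * (g s - g a).
    have [e /= e0 he] := hq.
    exists e => //= s /=; rewrite distrC => sa sna.
    have := he (s - a); rewrite /= sub0r normrN subr_eq0 subrK => H.
    exact: H.
  have [e /= e0 he] : \forall s \near a, [/\ is_derive (s : R) 1 f (g s), f s <= f a &
        s != a -> 0 < (s - a)^-1 * (g s - g a)].
    by near=> s; split; near: s.
  by exists e => // s sa; apply: he; rewrite /= distrC.
pose h := e / 2.
have h0 : 0 < h by rewrite divr_gt0.
have he' : h < e by rewrite /h; lra.
have cont s : `|s - a| < e -> {for s, continuous f}.
  move=> /he[fd _ _].
  exact/differentiable_continuous/derivable1_diffP/ex_derive.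
have [ga|ga] := leP 0 (g a).
- have ah : a < a + h by rewrite ltrDl.
  have [c||c] := @MVT R f g _ _ ah.
  + rewrite in_itv/= => /andP[c1 c2].
    by have [] := he c; rewrite ?ltr_norml//; apply/andP; split; lra.
  + apply: continuous_in_subspaceT => c; rewrite inE/= in_itv/= => /andP[c1 c2].
    by apply: cont; rewrite ltr_norml; apply/andP; split; lra.
  rewrite in_itv/= => /andP[c1 c2].
  have [|_ _ /(_ _)] := he c; first by rewrite ltr_norml; apply/andP; split; lra.
  rewrite (gt_eqF c1) => /(_ isT); rewrite pmulr_rgt0 ?invr_gt0 ?subr_gt0// => gc.
  have [|_ fa _] := he (a + h).
    by rewrite addrAC subrr add0r gtr0_norm.
  rewrite addrAC subrr add0r => fE.
  have : 0 < g c * h by rewrite mulr_gt0// (le_lt_trans ga).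
  by lra.
- have ah : a - h < a by rewrite ltrBlDr ltrDl.
  have [c||c] := @MVT R f g _ _ ah.
  + rewrite in_itv/= => /andP[c1 c2].
    by have [] := he c; rewrite ?ltr_norml//; apply/andP; split; lra.
  + apply: continuous_in_subspaceT => c; rewrite inE/= in_itv/= => /andP[c1 c2].
    by apply: cont; rewrite ltr_norml; apply/andP; split; lra.
  rewrite in_itv/= => /andP[c1 c2].
  have [|_ _ /(_ _)] := he c; first by rewrite ltr_norml; apply/andP; split; lra.
  rewrite (lt_eqF c2) => /(_ isT); rewrite nmulr_rgt0 ?invr_lt0 ?subr_lt0// => gc.
  have [|_ fa _] := he (a - h).
    by rewrite addrAC subrr add0r normrN gtr0_norm.
  rewrite subKr => fE.
  have : g c * h < 0 by rewrite nmulr_rlt0// (lt_trans gc).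
  by lra.
Unshelve. all: by end_near. Qed.

Lemma is_derive_slice_x (R : realType) (u : R * R -> R) (x y : R) :
  derivable u (x, y) (1, 0) ->
  is_derive x 1 (fun s => u (s, y)) ('D_(1, 0) u (x, y)).
Proof.
move=> ud; have E : (fun h : R => h^-1 *: (u (h *: (1, 0) + (x, y)) - u (x, y))) =
    (fun h : R => h^-1 *: (u (h *: 1 + x, y) - u (x, y))).
  apply/funext => h; congr (_ *: (u _ - _)).
  by apply/pair_equal_spec; split => //=; rewrite scaler0 add0r.
by split; [rewrite /derivable -E|rewrite /derive -E].
Qed.

Lemma is_derive_slice_y (R : realType) (u : R * R -> R) (x y : R) :
  derivable u (x, y) (0, 1) ->
  is_derive y 1 (fun s => u (x, s)) ('D_(0, 1) u (x, y)).
Proof.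
move=> ud; have E : (fun h : R => h^-1 *: (u (h *: (0, 1) + (x, y)) - u (x, y))) =
    (fun h : R => h^-1 *: (u (x, h *: 1 + y) - u (x, y))).
  apply/funext => h; congr (_ *: (u _ - _)).
  by apply/pair_equal_spec; split => //=; rewrite scaler0 add0r.
by split; [rewrite /derivable -E|rewrite /derive -E].
Qed.

Lemma is_derive_add (R : realType) (f g : R -> R) (x a b : R) :
  is_derive x 1 f a -> is_derive x 1 g b ->
  is_derive x 1 (fun z => f z + g z) (a + b).
Proof. by move=> hf hg; exact: (is_deriveD hf hg). Qed.

Lemma is_derive_sub (R : realType) (f g : R -> R) (x a b : R) :
  is_derive x 1 f a -> is_derive x 1 g b ->
  is_derive x 1 (fun z => f z - g z) (a - b).
Proof. by move=> hf hg; exact: (is_deriveB hf hg). Qed.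

Lemma is_derive_scale (R : realType) (k : R) (f : R -> R) (x a : R) :
  is_derive x 1 f a -> is_derive x 1 (fun z => k * f z) (k * a).
Proof. by move=> hf; exact: (is_deriveZ k hf). Qed.

Lemma is_derive_const (R : realType) (k x : R) : is_derive x 1 (fun=> k) 0.
Proof. exact: is_derive_cst. Qed.

Lemma is_derive_translate (R : realType) (x0 x : R) :
  is_derive x 1 (fun z => z - x0) 1.
Proof.
by have := is_derive_sub (is_derive_id x 1) (is_derive_const x0 x); rewrite subr0.
Qed.

Lemma is_derive_translate_sqr (R : realType) (x0 x : R) :
  is_derive x 1 (fun z => (z - x0) ^+ 2) (2 * (x - x0)).
Proof.
have h := is_derive_translate x0 x.
have := is_deriveM h h.
by rewrite /GRing.scale/= !mulr1 mulr_natl mulr2n; apply.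
Qed.

(** * The maximum principle in a sector *)

Lemma is_derive_cpowR (R : realType) (c p x : R) : 0 < x ->
  is_derive x 1 (fun z => c * z `^ p) (c * (p * x `^ (p - 1))).
Proof. by move=> x0; apply: is_derive_scale; exact: is_derive1_powR. Qed.

(** With [tau = (p.1 - x0) / p.2], this is [p.2 `^ (2^-1 - beta)] times
    [e + m * p.2 `^ (2 * beta) + h * p.2 `^ (- s) * (A - tau ^+ 2)]. The first
    two terms solve the eigenvalue equation; [e] serves on the sides of a sector
    at [x0] and [m] at its top. The last one is a strict supersolution when [s]
    is small, and its blow-up at [x0] deals with the vertex. *)
Definition barrier (R : realType) (beta x0 e m h A s : R) (p : R * R) : R :=
  e * p.2 `^ (2^-1 - beta) + m * p.2 `^ (2^-1 + beta) +
  h * (A * p.2 `^ (2^-1 - beta - s) -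
       (p.1 - x0) ^+ 2 * p.2 `^ (2^-1 - beta - s - 2)).

Lemma powR_mul_sqr (R : realType) (y p : R) : 0 < y ->
  y ^+ 2 * y `^ (p - 2) = y `^ p.
Proof.
move=> y0; rewrite -powR_mulrn ?ltW// -powRD; last by rewrite (gt_eqF y0) implybT.
by rewrite addrC subrK.
Qed.

Section maximum_principle.
Context {R : realType}.
Variables (beta x0 L e m h A s sg : R) (u : R * R -> R).
Hypotheses (beta0 : 0 < beta) (h0 : 0 < h) (s0 : 0 < s)
  (sA : (s ^+ 2 + 2 * beta * s) * A < 2).
Hypothesis heig : eigenfunction (beta ^+ 2 - 4^-1) u.

Let v (p : R * R) := sg * (u p - L * p.2 `^ (2^-1 - beta)).
Let psi := barrier beta x0 e m h A s.

(** The maximum principle. Let [c] be the eigenvalue and [Delta] the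
    Laplace-Beltrami operator. Where [v - k psi] has a maximum equal to [0], its
    image under [Delta] is nonpositive; but it is also equal to
    [c v - k Delta psi = k (c psi - Delta psi)], which is positive. The last
    sign comes from [Delta (y `^ p) = p (p - 1) y `^ p] and from
    [p (p - 1) - c = (p - 2^-1) ^+ 2 - beta ^+ 2]. *)
Lemma no_touching (k x y : R) : 0 < k -> 0 < y ->
  (\forall z \near x, v (z, y) <= k * psi (z, y)) ->
  (\forall z \near y, v (x, z) <= k * psi (x, z)) ->
  v (x, y) = k * psi (x, y) -> False.
Proof.
move=> k0 y0 hx hy veq.
have [C2 eig] := heig.
have [cu Du] := C2 (x, y) y0.
have [_ _ /(_ (1, 0)) [dxx _]] := Du (1, 0).
have [_ _ /(_ (0, 1)) [dyy _]] := Du (0, 1).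
set uxx := 'D_(1, 0) ('D_(1, 0) u) (x, y).
set uyy := 'D_(0, 1) ('D_(0, 1) u) (x, y).
pose p1 := 2^-1 - beta; pose p2 := 2^-1 + beta; pose p3 := p1 - s.
have lx : sg * uxx + k * h * y `^ (p3 - 2) * 2 <= 0.
  pose g (z : R) : R :=
    sg * 'D_(1, 0) u (z, y) + k * h * y `^ (p3 - 2) * (2 * (z - x0)).
  apply: (@second_derivative_le0 _ (fun z => v (z, y) - k * psi (z, y)) g x).
  - near=> z; rewrite /v /psi /barrier /=.
    have [] := C2 (z, y) y0 => _ /(_ (1, 0)) [du _ _].
    rewrite (_ : g z = sg * ('D_(1, 0) u (z, y) - 0) -
      k * (0 + h * (0 - y `^ (p3 - 2) * (2 * (z - x0))))); last by rewrite /g; ring.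
    apply: is_derive_sub.
      apply: is_derive_scale; apply: is_derive_sub.
        exact: (is_derive_slice_x du).
      exact: is_derive_const.
    apply: is_derive_scale; apply: is_derive_add; first exact: is_derive_const.
    apply: is_derive_scale; apply: is_derive_sub; first exact: is_derive_const.
    rewrite (_ : (fun w => (w - x0) ^+ 2 * _) =
      fun w => y `^ (p3 - 2) * (w - x0) ^+ 2).
      by apply: is_derive_scale; exact: is_derive_translate_sqr.
    by apply/funext => w; rewrite mulrC.
  - have hD := is_derive_slice_x dxx.
    have hT := is_derive_scale 2 (is_derive_translate x0 x).
    have := is_derive_add (is_derive_scale sg hD)
      (is_derive_scale (k * h * y `^ (p3 - 2)) hT).
    by rewrite mulr1.
  - rewrite veq subrr; near=> z; rewrite subr_le0; near: z; exact: hx.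
pose X := (x - x0) ^+ 2.
pose der2 (c p : R) : R := c * (p * ((p - 1) * y `^ (p - 1 - 1))).
have ly : sg * (uyy - der2 L p1) -
    k * (der2 e p1 + der2 m p2 + h * (der2 A p3 - der2 X (p3 - 2))) <= 0.
  pose der (c p z : R) : R := c * (p * z `^ (p - 1)).
  pose g (z : R) : R := sg * ('D_(0, 1) u (x, z) - der L p1 z) -
    k * (der e p1 z + der m p2 z + h * (der A p3 z - der X (p3 - 2) z)).
  have dder c p : is_derive y 1 (der c p) (der2 c p).
    by apply: is_derive_scale; exact: is_derive_cpowR.
  apply: (@second_derivative_le0 _ (fun z => v (x, z) - k * psi (x, z)) g y).
  - near=> z; rewrite /v /psi /barrier /=.
    have z0 : 0 < z by near: z; exact: lt_nbhsr.
    have [] := C2 (x, z) z0 => _ /(_ (0, 1)) [du _ _].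
    have pw c p := is_derive_cpowR c p z0.
    exact: (is_derive_sub
      (is_derive_scale sg (is_derive_sub (is_derive_slice_y du) (pw L p1)))
      (is_derive_scale k (is_derive_add (is_derive_add (pw e p1) (pw m p2))
        (is_derive_scale h (is_derive_sub (pw A p3) (pw X (p3 - 2))))))).
  - exact: (is_derive_sub
      (is_derive_scale sg (is_derive_sub (is_derive_slice_y dyy) (dder L p1)))
      (is_derive_scale k (is_derive_add (is_derive_add (dder e p1) (dder m p2))
        (is_derive_scale h (is_derive_sub (dder A p3) (dder X (p3 - 2))))))).
  - rewrite veq subrr; near=> z; rewrite subr_le0; near: z; exact: hy.
have /= eq := eig (x, y) y0.
rewrite /laplace_beltrami/= -/uxx -/uyy in eq.
have yder2 c p : y ^+ 2 * der2 c p = c * (p * (p - 1) * y `^ p).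
  rewrite /der2 -addrA -opprD -[1 + 1]/(2%:R) -(powR_mul_sqr p y0); ring.
have := lerD lx ly; rewrite addr0.
rewrite -(ler_pM2l (exprn_gt0 2 y0)) mulr0 leNgt => /negP; apply.
set P1 := y `^ p1; set P2 := y `^ p2; set P3 := y `^ p3; set P4 := y `^ (p3 - 2).
have P30 : 0 < P3 by exact: powR_gt0.
have P40 : 0 <= X * P4 by rewrite mulr_ge0 ?sqr_ge0 ?powR_ge0.
have y2P4 : y ^+ 2 * P4 = P3 by exact: powR_mul_sqr.
rewrite [ltRHS](_ : _ = sg * (y ^+ 2 * (uxx + uyy) - y ^+ 2 * der2 L p1)
  - k * (y ^+ 2 * der2 e p1 + y ^+ 2 * der2 m p2 +
     h * (y ^+ 2 * der2 A p3 - y ^+ 2 * der2 X (p3 - 2) - 2 * (y ^+ 2 * P4))));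
  last by rewrite /P4; ring.
rewrite !yder2 eq y2P4 -/P1 -/P2 -/P3 -/P4.
move: veq; rewrite /v /psi /barrier/= -/p1 -/p2 -/p3 -/P1 -/P2 -/P3 -/P4 -/X => veq.
rewrite [ltRHS](_ : _ = k * h * ((2 - (s ^+ 2 + 2 * beta * s) * A) * P3 +
   ((beta + s + 2) ^+ 2 - beta ^+ 2) * (X * P4))); last first.
  have -> : sg * ((beta ^+ 2 - 4^-1) * u (x, y) - L * (p1 * (p1 - 1) * P1)) =
      (beta ^+ 2 - 4^-1) * (sg * (u (x, y) - L * P1)).
    by rewrite /p1; field.
  by rewrite veq /p3 /p2 /p1; field.
have q : 0 <= (beta + s + 2) ^+ 2 - beta ^+ 2.
  rewrite subr_sqr mulr_ge0//; move: beta0 s0; lra.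
apply: mulr_gt0; first exact: mulr_gt0.
by apply: ltr_pwDl; [rewrite mulr_gt0// subr_gt0|exact: mulr_ge0].
Unshelve. all: by end_near. Qed.

End maximum_principle.

Lemma barrier_ray (R : realType) (beta x0 e m h A s tau y : R) : 0 < y ->
  barrier beta x0 e m h A s (x0 + tau * y, y) =
  e * y `^ (2^-1 - beta) + m * y `^ (2^-1 + beta) +
  h * ((A - tau ^+ 2) * y `^ (2^-1 - beta - s)).
Proof.
move=> y0; rewrite /barrier/= -(powR_mul_sqr (2^-1 - beta - s) y0); ring.
Qed.

Lemma continuous_powR_snd (R : realType) (a : R) (p : R * R) : 0 < p.2 ->
  {for p, continuous (fun q : R * R => q.2 `^ a)}.
Proof.
move=> p0; apply: (@continuous_comp _ _ _ snd (fun y : R => y `^ a)).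
  exact: cvg_snd.
exact/differentiable_continuous/derivable1_diffP/ex_derive/is_derive1_powR.
Qed.

(** On the sector truncated at a small height [d], the quotient of the two sides
    has a maximum [k]. On the sides, at the top and at the bottom the barrier is
    larger by construction, and [no_touching] excludes an interior maximum with
    [k > 1]. *)
Lemma sector_barrier (R : realType)
    (beta x0 L e m h A s sg a1 a2 delta M : R) (u : R * R -> R) :
  0 < beta -> 0 < h -> 0 < s -> (s ^+ 2 + 2 * beta * s) * A < 2 ->
  eigenfunction (beta ^+ 2 - 4^-1) u ->
  0 < e -> 0 <= m -> 0 <= M ->
  M * delta `^ (2^-1 - beta) <= m * delta `^ (2^-1 + beta) ->
  (forall tau, a1 <= tau <= a2 -> tau ^+ 2 + 1 <= A) ->
  (forall y tau, 0 < y <= delta -> tau = a1 \/ tau = a2 ->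
    sg * (u (x0 + tau * y, y) - L * y `^ (2^-1 - beta)) <=
      e * y `^ (2^-1 - beta)) ->
  (forall y tau, 0 < y <= delta -> a1 <= tau <= a2 ->
    sg * (u (x0 + tau * y, y) - L * y `^ (2^-1 - beta)) <=
      M * y `^ (2^-1 - beta)) ->
  forall y tau, 0 < y <= delta -> a1 <= tau <= a2 ->
    sg * (u (x0 + tau * y, y) - L * y `^ (2^-1 - beta)) <=
      barrier beta x0 e m h A s (x0 + tau * y, y).
Proof.
move=> beta0 h0 s0 sA heig e0 m0 M0 Mm tauA side bd ys taus /andP[ys0 ysd] htaus.
pose p1 := 2^-1 - beta; pose p2 := 2^-1 + beta; pose p3 := p1 - s.
pose v (p : R * R) := sg * (u p - L * p.2 `^ p1).
pose psi := barrier beta x0 e m h A s.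
have psiE tau y : 0 < y -> psi (x0 + tau * y, y) =
    e * y `^ p1 + m * y `^ p2 + h * ((A - tau ^+ 2) * y `^ p3).
  exact: barrier_ray.
have low1 y : 0 < y -> 0 < e * y `^ p1 by move=> y0; rewrite mulr_gt0 ?powR_gt0.
have low2 y : 0 <= m * y `^ p2 by rewrite mulr_ge0 ?powR_ge0.
have low3 tau y : a1 <= tau <= a2 -> 0 < y ->
    h * y `^ p3 <= h * ((A - tau ^+ 2) * y `^ p3).
  move=> ht y0; rewrite ler_pM2l// ler_peMl ?powR_ge0//.
  by have := tauA _ ht; lra.
have hp3 y : 0 < y -> 0 < h * y `^ p3 by move=> y0; rewrite mulr_gt0 ?powR_gt0.
have psi0 tau y : a1 <= tau <= a2 -> 0 < y -> 0 < psi (x0 + tau * y, y).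
  move=> ht y0; rewrite psiE//.
  by have := low1 _ y0; have := low2 y; have := low3 _ _ ht y0; have := hp3 _ y0; lra.
(* at height [d] the last term of the barrier alone exceeds [M] *)
have [d [d0 dys Md]] : exists d, [/\ 0 < d, d <= ys & M * d `^ p1 <= h * d `^ p3].
  pose r := (h / (M + 1)) `^ s^-1.
  have q0 : 0 < h / (M + 1) by rewrite divr_gt0// ltr_wpDl.
  have r0 : 0 < r by exact: powR_gt0.
  exists (Num.min ys r).
  have d0 : 0 < Num.min ys r by rewrite lt_min ys0.
  split => //; first by rewrite ge_min lexx.
  set d := Num.min ys r in d0 *.
  have ds : d `^ s <= h / (M + 1).
    have -> : h / (M + 1) = r `^ s.
      by rewrite /r -powRrM mulVf ?gt_eqF// powRr1// ltW.
    have dr : d <= r by rewrite ge_min lexx orbT.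
    by apply: ge0_ler_powR; rewrite ?nnegrE ?(ltW s0) ?(ltW d0) ?(ltW r0).
  have -> : d `^ p1 = d `^ s * d `^ p3.
    rewrite -powRD; last by rewrite (gt_eqF d0) implybT.
    by rewrite /p3 addrC subrK.
  rewrite mulrA ler_wpM2r ?powR_ge0//.
  rewrite ler_pdivlMr ?ltr_wpDl// in ds.
  by have := powR_ge0 d s; nra.
pose K := `[a1, a2] `*` `[d, delta] : set (R * R).
have KP tau y : K (tau, y) <-> (a1 <= tau <= a2) /\ (d <= y <= delta).
  by rewrite /K /= !in_itv.
have d_gt0 y : d <= y -> 0 < y by exact: lt_le_trans.
pose q (p : R * R) := v (x0 + p.1 * p.2, p.2) / psi (x0 + p.1 * p.2, p.2).
have K0 : K !=set0 by exists (taus, ys); apply/KP; rewrite dys ysd.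
have cK : compact K by apply: compact_setX; exact: segment_compact.
have cq : {within K, continuous q}.
  apply: continuous_in_subspaceT => -[tau y]; rewrite inE => /KP[ht /andP[dy yd]].
  have y0 := d_gt0 _ dy.
  pose g (p : R * R) := (x0 + p.1 * p.2, p.2).
  have cg : {for (tau, y), continuous g}.
    have cg1 : {for (tau, y), continuous (fun p : R * R => x0 + p.1 * p.2)}.
      apply: cvgD; first exact: cvg_cst.
      by apply: cvgM; [exact: cvg_fst|exact: cvg_snd].
    have cg2 : {for (tau, y), continuous (@snd R R)} by exact: cvg_snd.
    exact: (cvg_pair cg1 cg2).
  have [C2 _] := heig; have [cu _] := C2 (g (tau, y)) y0.
  have cpow a := @continuous_powR_snd R a (g (tau, y)) y0.
  have cfst : {for g (tau, y), continuous fst} by exact: cvg_fst.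
  have cv : {for g (tau, y), continuous v}.
    apply: cvgM; first exact: cvg_cst.
    by apply: cvgB => //; apply: cvgM; [exact: cvg_cst|exact: cpow].
  have cpsi : {for g (tau, y), continuous psi}.
    apply: cvgD; first apply: cvgD.
    - by apply: cvgM; [exact: cvg_cst|exact: cpow].
    - by apply: cvgM; [exact: cvg_cst|exact: cpow].
    - apply: cvgM; first exact: cvg_cst.
      apply: cvgB; first by apply: cvgM; [exact: cvg_cst|exact: cpow].
      apply: cvgM; last exact: cpow.
      have cfx : {for g (tau, y), continuous (fun p : R * R => p.1 - x0)}.
        by apply: cvgB => //; exact: cvg_cst.
      exact: (cvgM cfx cfx).
  have cq' : {for g (tau, y), continuous (fun p => v p / psi p)}.
    by apply: cvgM => //; apply: cvgV => //; rewrite gt_eqF// psi0.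
  exact: (continuous_comp cg cq').
have [[tm ym]] := compact_EVT_max K0 cK cq.
rewrite inE => /KP[htm /andP[dym ymd]] qmax.
have ym0 := d_gt0 _ dym.
set k := q (tm, ym) in qmax.
have vpsi tau y : a1 <= tau <= a2 -> d <= y <= delta ->
    v (x0 + tau * y, y) <= k * psi (x0 + tau * y, y).
  move=> ht /[dup] /andP[dy _] hy.
  rewrite -ler_pdivrMr ?psi0 ?d_gt0//.
  by have := qmax (tau, y); apply; rewrite inE; apply/KP.
have vE : v (x0 + tm * ym, ym) = k * psi (x0 + tm * ym, ym).
  by rewrite /k /q /= divfK// gt_eqF// psi0.
have psimE := psiE tm ym ym0.
have [k1|k1] := leP k 1.
  have /(le_trans (vpsi taus ys _ _)) := ler_piMl (ltW (psi0 _ _ htaus ys0)) k1.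
  by apply => //; rewrite dys.
exfalso.
have psi_lt : psi (x0 + tm * ym, ym) < v (x0 + tm * ym, ym).
  by rewrite vE ltr_pMl// psi0.
have l1 := low1 _ ym0; have l2 := low2 ym; have l3 := low3 _ _ htm ym0.
have l4 := hp3 _ ym0.
have ymI : 0 < ym <= delta by rewrite ym0.
have tm1 : tm <> a1.
  move=> tE; have := side ym tm ymI (or_introl tE).
  by rewrite -/p1 -/(v (x0 + tm * ym, ym)); lra.
have tm2 : tm <> a2.
  move=> tE; have := side ym tm ymI (or_intror tE).
  by rewrite -/p1 -/(v (x0 + tm * ym, ym)); lra.
have bdm : v (x0 + tm * ym, ym) <= M * ym `^ p1 by exact: bd.
have ymd' : ym <> delta.
  by move=> yE; move: bdm; rewrite yE in psi_lt psimE l1 l2 l3 l4 *; lra.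
have dym' : ym <> d.
  by move=> yE; move: bdm; rewrite yE in psi_lt psimE l1 l2 l3 l4 *; lra.
have t1 : a1 < tm by rewrite lt_neqAle eq_sym (introN eqP tm1); case/andP: htm.
have t2 : tm < a2 by rewrite lt_neqAle (introN eqP tm2); case/andP: htm.
have y1 : d < ym by rewrite lt_neqAle eq_sym (introN eqP dym').
have y2 : ym < delta by rewrite lt_neqAle (introN eqP ymd').
have k0 : 0 < k by exact: lt_trans k1.
apply: (no_touching beta0 h0 s0 sA heig k0 ym0 _ _ vE).
- near=> z.
  have -> : z = x0 + ((z - x0) / ym) * ym by rewrite divfK ?gt_eqF// addrC subrK.
  apply: vpsi; last by rewrite dym.
  rewrite ler_pdivlMr// ler_pdivrMr//.
  have z1 : x0 + a1 * ym < z.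
    by near: z; apply: lt_nbhsr; rewrite ltrD2l ltr_pM2r.
  have z2 : z < x0 + a2 * ym.
    by near: z; apply: lt_nbhsl; rewrite ltrD2l ltr_pM2r.
  by apply/andP; split; lra.
- have clin a : {for ym, continuous (fun z : R => a * z)}.
    by apply: cvgM; [exact: cvg_cst|exact: cvg_id].
  have lt1 : a1 * ym < tm * ym by rewrite ltr_pM2r.
  have lt2 : tm * ym < a2 * ym by rewrite ltr_pM2r.
  near=> z.
  have z0 : 0 < z by near: z; exact: lt_nbhsr.
  have -> : x0 + tm * ym = x0 + (tm * ym / z) * z by rewrite divfK ?gt_eqF.
  apply: vpsi.
    rewrite ler_pdivlMr// ler_pdivrMr//; apply/andP; split; apply: ltW.
      by near: z; exact: (cvgr_lt _ (clin a1) _ lt1).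
    by near: z; exact: (cvgr_gt _ (clin a2) _ lt2).
  apply/andP; split; apply: ltW.
    by near: z; exact: lt_nbhsr.
  by near: z; exact: lt_nbhsl.
Unshelve. all: by end_near. Qed.

(** * The Poisson kernel and the Harnack inequality *)

(** The squared Euclidean distance from [(x, y)] to the boundary point [t]. *)
Definition quad (R : realType) (x y t : R) : R := (t - x) ^+ 2 + y ^+ 2.

Lemma quad_gt0 (R : realType) (x y t : R) : 0 < y -> 0 < quad x y t.
Proof. by move=> y0; rewrite ltr_wpDl ?sqr_ge0// exprn_gt0. Qed.

(** The triangle inequality: moving the point by [eta * y] multiplies its distance
    to a boundary point, which is at least [y], by at most [1 + eta]. *)
Lemma quad_le (R : realType) (eta x x' y t : R) : 0 < y -> 0 <= eta ->
  `|x - x'| <= eta * y -> quad x' y t <= (1 + eta) ^+ 2 * quad x y t.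
Proof.
move=> y0 eta0; rewrite ler_norml => /andP[h1 h2]; rewrite /quad.
pose a := t - x; pose d := x - x'.
have -> : t - x' = a + d by rewrite /a /d addrA subrK.
rewrite -/a.
have hd : d ^+ 2 <= (eta * y) ^+ 2 by rewrite /d; nra.
have hE : 0 <= eta * y ^+ 2 by rewrite mulr_ge0// sqr_ge0.
have [etaE|eta_neq0] := eqVneq eta 0.
  rewrite etaE in h1 h2 *; have -> : d = 0 by rewrite /d; lra.
  by rewrite !addr0 expr1n mul1r.
have etap : 0 < eta by rewrite lt_neqAle eq_sym eta_neq0.
have h3 : eta * (2 * (a * d)) <= eta * (eta * a ^+ 2 + eta * y ^+ 2).
  have : 0 <= (eta * a - d) ^+ 2 by exact: sqr_ge0.
  nra.
rewrite (ler_pM2l etap) in h3.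
have : 0 <= eta * a ^+ 2 by rewrite mulr_ge0// sqr_ge0.
have : 0 <= eta ^+ 2 * a ^+ 2 by rewrite mulr_ge0// sqr_ge0.
by nra.
Qed.

Lemma measurable_quad (R : realType) (x y : R) :
  measurable_fun setT (quad x y).
Proof.
apply: measurable_funD => //; apply: measurable_funX; exact: measurable_funB.
Qed.

Lemma measurable_quad_powR (R : realType) (x y a : R) :
  measurable_fun setT (fun t => quad x y t `^ a).
Proof.
apply: (@measurableT_comp _ _ _ _ _ _ (fun z : R => z `^ a)) => //.
exact: measurable_quad.
Qed.

Lemma poisson_kernelE (R : realType) (s x y t : R) : 0 < y ->
  (y / (y ^+ 2 + (x - t) ^+ 2)) `^ s = y `^ s * quad x y t `^ (- s).
Proof.
move=> y0; have q0 := quad_gt0 x t y0.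
have -> : y ^+ 2 + (x - t) ^+ 2 = quad x y t.
  by rewrite /quad addrC -[X in X + _]sqrrN opprB.
by rewrite powRM ?invr_ge0 ?ltW// -powR_inv1 ?ltW// -powRrM mulN1r.
Qed.

Lemma c_ge0 (R : realType) (beta : R) : 0 <= c_ beta.
Proof. by rewrite invr_ge0; apply: Rintegral_ge0 => t _; exact: powR_ge0. Qed.

(** The kernel satisfies the inequality for each [t], and so does the term
    [C * y `^ (beta + 2^-1)] as the constant is at least [1]. *)
Lemma harnack (R : realType) (beta : R) (u : R * R -> R)
    (mu : {measure set (measurableTypeR R) -> \bar R}) (x x' y eta : R) :
  0 < beta -> boundary_measure beta u mu -> 0 < y -> 0 <= eta ->
  `|x - x'| <= eta * y ->
  u (x, y) <= ((1 + eta) ^+ 2) `^ (beta + 2^-1) * u (x', y).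
Proof.
move=> beta0 [C C0 hu] y0 eta0 hx.
set s := beta + 2^-1 in hu *; set K := ((1 + eta) ^+ 2) `^ s.
have s0 : 0 < s by rewrite addr_gt0.
have eta2 : 1 <= (1 + eta) ^+ 2 by rewrite exprn_ege1// lerDl.
have K1 : 1 <= K.
  by rewrite -[leLHS](powRr0 ((1 + eta) ^+ 2)) ler_powR// ltW.
have K0 : 0 <= K by exact: le_trans ler01 K1.
have I0 : (0 <= \int[mu]_t ((y / (y ^+ 2 + (x' - t) ^+ 2)) `^ s)%:E)%E.
  by apply: integral_ge0 => t _; rewrite lee_fin powR_ge0.
suff : ((u (x, y))%:E <= K%:E * (u (x', y))%:E)%E by rewrite -EFinM lee_fin.
rewrite (hu x y y0) (hu x' y y0).
set I := (\int[mu]_t ((y / (y ^+ 2 + (x' - t) ^+ 2)) `^ s)%:E)%E in I0 *.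
have cI0 : (0 <= (c_ beta)%:E * I)%E by apply: mule_ge0 => //; rewrite lee_fin c_ge0.
have Cy0 : (0 <= (C * y `^ s)%:E)%E by rewrite lee_fin mulr_ge0// powR_ge0.
rewrite (ge0_muleDr K%:E Cy0 cI0) {cI0 I0}/I.
apply: leeD.
  by rewrite -EFinM lee_fin ler_peMl// mulr_ge0 ?powR_ge0.
rewrite muleCA; apply: lee_wpmul2l; first by rewrite lee_fin c_ge0.
have mk z : measurable_fun setT (fun t : R => ((y / (y ^+ 2 + (z - t) ^+ 2)) `^ s)%:E).
  under eq_fun do rewrite poisson_kernelE//.
  apply/measurable_EFinP; apply: measurable_funM => //.
  exact: measurable_quad_powR.
rewrite -ge0_integralZl//; [|exact: mk
  |by move=> t _; rewrite lee_fin powR_ge0].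
apply: ge0_le_integral => //.
- by move=> t _; rewrite lee_fin powR_ge0.
- exact: mk.
- by apply: measurable_funeM; exact: mk.
- move=> t _; rewrite -EFinM lee_fin !poisson_kernelE// mulrCA.
  rewrite ler_wpM2l ?powR_ge0//.
  have q0 := quad_gt0 x t y0; have q0' := quad_gt0 x' t y0.
  rewrite !powRN ler_pdivlMr ?powR_gt0// mulrC ler_pdivrMr ?powR_gt0//.
  rewrite -powRM ?(ltW q0)// ?exprn_ge0 ?addr_ge0//.
  apply: ge0_ler_powR; rewrite ?nnegrE ?(ltW s0) ?(ltW q0')//.
    by rewrite mulr_ge0 ?sqr_ge0// ltW.
  exact: quad_le.
Qed.

(** A Phragmen-Lindelof argument. On two rays [F = p.2 `^ (beta - 2^-1) * u p] is
    within [e / 3] of [L], and between them it is bounded by comparison with the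
    first ray. [sector_barrier] applies to [u - L * y `^ (2^-1 - beta)] and to its
    opposite; at a given height [y] the coefficient [h] of the singular term is
    chosen so that this term contributes at most [e / 3]. *)
Lemma sector_limit (R : realType) (beta x0 L K a1 a2 : R) (u : R * R -> R) :
  0 < beta -> eigenfunction (beta ^+ 2 - 4^-1) u ->
  positive_on_half_plane u -> 0 <= L -> a1 < a2 -> 0 <= K ->
  (forall tau y, a1 <= tau <= a2 -> 0 < y ->
    u (x0 + tau * y, y) <= K * u (x0 + a1 * y, y)) ->
  radial_limit (fun p : R * R => p.2 `^ (beta - 2^-1) * u p) x0 a1 L ->
  radial_limit (fun p : R * R => p.2 `^ (beta - 2^-1) * u p) x0 a2 L ->
  forall tau, a1 <= tau <= a2 ->
  radial_limit (fun p : R * R => p.2 `^ (beta - 2^-1) * u p) x0 tau L.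
Proof.
move=> beta0 heig upos L0 a12 K0 har lim1 lim2 tau htau.
apply/cvgrPdist_le => e e0.
pose p1 := 2^-1 - beta.
pose A := 1 + (a1 ^+ 2 + a2 ^+ 2).
have A0 : 0 < A by rewrite ltr_wpDr// addr_ge0 ?sqr_ge0.
have tauA t : a1 <= t <= a2 -> t ^+ 2 + 1 <= A.
  move=> /andP[t1 t2]; rewrite addrC lerD2l.
  have := sqr_ge0 a1; have := sqr_ge0 a2.
  by have [t0|/ltW t0] := leP 0 t; nra.
pose s := ((1 + 2 * beta) * A)^-1.
have bA : 0 < (1 + 2 * beta) * A by rewrite mulr_gt0// addr_gt0// mulr_gt0.
have s0 : 0 < s by rewrite invr_gt0.
have sE : s * ((1 + 2 * beta) * A) = 1 by rewrite mulVf// gt_eqF.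
have s1 : s <= 1.
  rewrite invf_le1//; have : 0 <= a1 ^+ 2 + a2 ^+ 2 by rewrite addr_ge0 ?sqr_ge0.
  by rewrite /A; nra.
have sA : (s ^+ 2 + 2 * beta * s) * A < 2.
  apply: (@le_lt_trans _ _ (s * ((1 + 2 * beta) * A))); last by rewrite sE ltr1n.
  have : s ^+ 2 * A <= s * A by rewrite ler_pM2r// expr2 ler_piMl// ltW.
  by nra.
have e3 : 0 < e / 3 by rewrite divr_gt0.
have cancelp y : 0 < y -> y `^ (beta - 2^-1) * y `^ p1 = 1.
  move=> y0; rewrite -powRD; last by rewrite (gt_eqF y0) implybT.
  by rewrite /p1 addrA subrK subrr powRr0.
have [delta delta0 hdelta] : exists2 delta : R, 0 < delta &
    forall y, 0 < y <= delta -> forall t, t = a1 \/ t = a2 ->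
      `|L - y `^ (beta - 2^-1) * u (x0 + t * y, y)| <= e / 3.
  have : \forall y \near (0 : R)^'+, forall t, t = a1 \/ t = a2 ->
      `|L - y `^ (beta - 2^-1) * u (x0 + t * y, y)| <= e / 3.
    move/cvgrPdist_le : lim1 => /(_ _ e3) lim1.
    move/cvgrPdist_le : lim2 => /(_ _ e3) lim2.
    by near=> y; move=> t [->|->]; near: y.
  move=> [d /= d0 hd]; exists (d / 2); first by rewrite divr_gt0.
  move=> y /andP[y0 yd]; apply: hd => //=.
  by rewrite sub0r normrN gtr0_norm//; lra.
(* estimates of [F - L] on both sides are estimates of two eigenfunctions *)
have scale y t b : 0 < y -> `|L - y `^ (beta - 2^-1) * u (x0 + t * y, y)| <= b <->
    forall sg : bool, (-1) ^+ sg * (u (x0 + t * y, y) - L * y `^ p1) <= b * y `^ p1.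
  move=> y0; have yp := powR_gt0 p1 y0; have E := cancelp y y0.
  set U := u _.
  have UE : U = y `^ (beta - 2^-1) * U * y `^ p1 by rewrite mulrAC E mul1r.
  have -> : (forall sg : bool, (-1) ^+ sg * (U - L * y `^ p1) <= b * y `^ p1) <->
      `|U - L * y `^ p1| <= b * y `^ p1.
    rewrite ler_norml lerNl; split=> [H|/andP[h1 h2] [|]];
      rewrite ?expr1 ?mulN1r ?expr0 ?mul1r//.
    by have := H true; have := H false; rewrite expr1 expr0 mulN1r mul1r => -> ->.
  rewrite [in X in _ <-> X]UE -mulrBl normrM (gtr0_norm yp) ler_pM2r//.
  by rewrite distrC.
pose M := K * (L + e / 3) + L.
have M0 : 0 <= M by rewrite addr_ge0// mulr_ge0// addr_ge0// ltW.
have bound y t : 0 < y <= delta -> a1 <= t <= a2 ->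
    `|L - y `^ (beta - 2^-1) * u (x0 + t * y, y)| <= M.
  move=> hy ht; have /andP[y0 _] := hy.
  have b0 : 0 < y `^ (beta - 2^-1) by exact: powR_gt0.
  have h1 := hdelta _ hy a1 (or_introl erefl).
  have h2 := har t y ht y0.
  have h3 : y `^ (beta - 2^-1) * u (x0 + t * y, y) <=
      K * (y `^ (beta - 2^-1) * u (x0 + a1 * y, y)).
    by rewrite mulrCA ler_pM2l.
  have h4 : 0 < y `^ (beta - 2^-1) * u (x0 + t * y, y) by rewrite mulr_gt0// upos.
  move: h1; rewrite ler_norml => /andP[h1 _].
  have h5 : K * (y `^ (beta - 2^-1) * u (x0 + a1 * y, y)) <= K * (L + e / 3).
    by rewrite ler_wpM2l//; lra.
  have h6 : 0 <= K * (L + e / 3) by rewrite mulr_ge0// addr_ge0// ltW.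
  by rewrite ler_norml /M; apply/andP; split; lra.
pose p2 := 2^-1 + beta.
pose m := M * delta `^ p1 / delta `^ p2.
have m0 : 0 <= m by rewrite divr_ge0 ?mulr_ge0 ?powR_ge0.
have Mm : M * delta `^ p1 <= m * delta `^ p2.
  by rewrite /m divfK// gt_eqF// powR_gt0.
have lim0 : m * y `^ (2 * beta) @[y --> 0^'+] --> (0 : R).
  rewrite -[X in _ --> X](mulr0 m); apply: cvgM; first exact: cvg_cst.
  by apply: powR_cvg0; rewrite mulr_gt0.
near=> y.
have y0 : 0 < y by near: y; exact: nbhs_right_gt.
have yd : y <= delta by near: y; exact: nbhs_right_le.
have ym : m * y `^ (2 * beta) <= e / 3.
  near: y; move/cvgrPdist_le : lim0 => /(_ _ e3).
  by apply: filterS => z; rewrite sub0r normrN => /(le_trans (ler_norm _)).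
apply/scale => // sg.
pose h := e / 3 * y `^ s / A.
have h0 : 0 < h by rewrite divr_gt0// mulr_gt0// powR_gt0.
have hy : 0 < y <= delta by rewrite y0.
have := @sector_barrier R beta x0 L (e / 3) m h A s ((-1) ^+ sg) a1 a2 delta M u
  beta0 h0 s0 sA heig e3 m0 M0 Mm tauA _ _ y tau hy htau.
rewrite -/p1 barrier_ray// -/p1 -/p2 => H; apply: le_trans (H _ _) _.
- move=> z t /[dup] hz /andP[z0 _] ht.
  exact: (proj1 (scale z t _ z0) (hdelta _ hz _ ht)).
- move=> z t /[dup] hz /andP[z0 _] ht.
  exact: (proj1 (scale z t _ z0) (bound _ _ hz ht)).
have -> : m * y `^ p2 = m * y `^ (2 * beta) * y `^ p1.
  rewrite -mulrA -powRD; last by rewrite (gt_eqF y0) implybT.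
  by congr (_ * _ `^ _); rewrite /p1 /p2; lra.
have -> : h * ((A - tau ^+ 2) * y `^ (p1 - s)) =
    e / 3 * ((A - tau ^+ 2) / A) * y `^ p1.
  have -> : y `^ p1 = y `^ s * y `^ (p1 - s).
    rewrite -powRD; last by rewrite (gt_eqF y0) implybT.
    by rewrite addrC subrK.
  by rewrite /h; field; rewrite gt_eqF.
rewrite -!mulrDl ler_pM2r ?powR_gt0//.
have : e / 3 * ((A - tau ^+ 2) / A) <= e / 3.
  by rewrite ler_piMr ?(ltW e3)// ler_pdivrMr// mul1r gerBl sqr_ge0.
by lra.
Unshelve. all: by end_near. Qed.

(** * From a sector to all directions *)

Lemma continuous_quad_powR (R : realType) (x y a : R) : 0 < y ->
  continuous (fun t => quad x y t `^ a).
Proof.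
move=> y0 t; apply: (@continuous_comp _ _ _ (quad x y) (fun z : R => z `^ a)).
  have ct : {for t, continuous (fun z : R => z - x)}.
    by apply: cvgB; [exact: cvg_id|exact: cvg_cst].
  by apply: cvgD; [exact: (cvgM ct ct)|exact: cvg_cst].
apply/differentiable_continuous/derivable1_diffP/ex_derive/is_derive1_powR.
exact: quad_gt0.
Qed.

Lemma quad_scale (R : realType) (x0 r x y t : R) : 0 < r ->
  quad (x0 + r * x) (r * y) t = r ^+ 2 * quad x y ((t - x0) / r).
Proof. by move=> r0; rewrite /quad; field; rewrite gt_eqF. Qed.

Lemma quad_powR_scale (R : realType) (s x0 r x y t : R) : 0 < r -> 0 < y ->
  r^-1 * quad x y ((t - x0) / r) `^ (- s) =
  r `^ (2 * s - 1) * quad (x0 + r * x) (r * y) t `^ (- s).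
Proof.
move=> r0 y0; have q0 := quad_gt0 x ((t - x0) / r) y0.
rewrite quad_scale// powRM ?sqr_ge0 ?ltW// mulrA; congr (_ * _).
rewrite -powR_inv1 ?ltW// -[r ^+ 2]powR_mulrn ?ltW// -powRrM.
rewrite -powRD; last by rewrite (gt_eqF r0) implybT.
by congr (_ `^ _); ring.
Qed.

(** Substitute [x + y * z] for [t]. As [c_ beta] is the inverse of a real-valued
    integral, the default value of which is [0], it vanishes when the integral
    diverges. *)
Lemma lebesgue_quad (R : realType) (beta x y : R) : 0 < y -> c_ beta != 0 ->
  (\int[@lebesgue_measure R]_t (quad x y t `^ (- (beta + 2^-1)))%:E =
    (y `^ (- (2 * beta)) / c_ beta)%:E)%E.
Proof.
move=> y0 c0; set s := beta + 2^-1.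
have dF (t : R) : is_derive t 1 (fun z => x + y * z) y.
  have := is_derive_add (is_derive_const x t) (is_derive_scale y (is_derive_id t 1)).
  by rewrite add0r mulr1.
have F'E : derive1 (fun z => x + y * z) = cst y.
  by apply/funext => t; rewrite derive1E; exact: derive_val.
rewrite (@increasing_ge0_integration_by_substitutionT R (fun z => x + y * z)
  (fun t => quad x y t `^ (- s))); first last.
- by move=> t; exact: powR_ge0.
- exact: continuous_quad_powR.
- apply/cvgryPge => A.
  apply: filterS (nbhs_pinfty_ge (num_real ((A - x) / y))) => t.
  by rewrite ler_pdivrMr// lerBlDr addrC mulrC.
- apply/cvgrNyPle => A.
  apply: filterS (nbhs_ninfty_le (num_real ((A - x) / y))) => t.
  by rewrite ler_pdivlMr// lerBrDr addrC mulrC.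
- by move=> t; apply: ex_derive; exact: dF.
- by rewrite F'E; apply/cvg_ex; exists y; exact: cvg_cst.
- by rewrite F'E; apply/cvg_ex; exists y; exact: cvg_cst.
- by rewrite F'E; exact: cst_continuous.
- by move=> t1 t2 t12; rewrite ltrD2l ltr_pM2l.
have -> : (fun t => ((((fun t => quad x y t `^ (- s)) \o (fun z => x + y * z)) *
    derive1 (fun z => x + y * z)) t)%:E) =
    (fun t => (y `^ (- (2 * beta)))%:E * ((1 + t ^+ 2) `^ (- beta - 2^-1))%:E)%E.
  apply/funext => t; rewrite -EFinM F'E; congr (_%:E).
  change (quad x y (x + y * t) `^ (- s) * y =
    y `^ (- (2 * beta)) * (1 + t ^+ 2) `^ (- beta - 2^-1)).
  have -> : quad x y (x + y * t) = y ^+ 2 * (1 + t ^+ 2) by rewrite /quad; ring.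
  rewrite powRM ?sqr_ge0 ?addr_ge0 ?sqr_ge0//.
  rewrite -[y ^+ 2]powR_mulrn ?ltW// -powRrM mulrAC; congr (_ * _ `^ _).
    rewrite -[X in _ * X](powRr1 (ltW y0)) -powRD; last by rewrite (gt_eqF y0) implybT.
    by congr (_ `^ _); rewrite /s; field.
  by rewrite /s opprD.
rewrite ge0_integralZl//; first last.
- by rewrite lee_fin powR_ge0.
- by move=> t _; rewrite lee_fin powR_ge0.
- have -> : (fun t : R => ((1 + t ^+ 2) `^ (- beta - 2^-1))%:E) =
      (fun t => (quad 0 1 t `^ (- beta - 2^-1))%:E).
    by apply/funext => t; rewrite /quad subr0 expr1n addrC.
  by apply/measurable_EFinP; exact: measurable_quad_powR.
rewrite EFinM; congr (_ * _)%E.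
move: c0; rewrite /c_ /Rintegral invrK invr_eq0.
by case: (\int[_]_t _)%E => //=; rewrite eqxx.
Qed.

Lemma boundary_measure_real (R : realType) (beta : R) (u : R * R -> R)
    (mu : {measure set (measurableTypeR R) -> \bar R}) :
  boundary_measure beta u mu -> 0 < c_ beta ->
  exists2 C : R, 0 <= C & forall x y, 0 < y ->
    mu.-integrable setT (EFin \o (fun t => quad x y t `^ (- (beta + 2^-1)))) /\
    u (x, y) = y `^ (beta + 2^-1) *
      (C + c_ beta * \int[mu]_t (quad x y t `^ (- (beta + 2^-1)))).
Proof.
move=> [C C0 hu] c0; exists C => // x y y0.
have := hu x y y0; set s := beta + 2^-1.
have ys : 0 < y `^ s by exact: powR_gt0.
have mq : measurable_fun setT (fun t => (quad x y t `^ (- s))%:E).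
  by apply/measurable_EFinP; exact: measurable_quad_powR.
have q0 t : (0 <= (quad x y t `^ (- s))%:E)%E by rewrite lee_fin powR_ge0.
under eq_integral do rewrite poisson_kernelE// EFinM.
rewrite ge0_integralZl//; last by rewrite lee_fin ltW.
set I := (\int[mu]_t (quad x y t `^ (- s))%:E)%E => uE.
have I0 : (0 <= I)%E by exact: integral_ge0.
have Ifin : (I < +oo)%E.
  rewrite ltey; apply/negP => /eqP IE; move: uE; rewrite IE.
  by rewrite mulry gtr0_sg// mul1e mulry gtr0_sg// mul1e addey.
split.
  apply/integrableP; split=> //.
  by under eq_integral do rewrite /= ger0_norm ?powR_ge0//; exact: Ifin.
have IE : I = (fine I)%:E by rewrite fineK// ge0_fin_numE.
rewrite /Rintegral -/I; move: uE; rewrite IE -!EFinM -EFinD => -[->] /=.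
by rewrite mulrDr; congr (_ + _); rewrite ?(mulrC C)// mulrCA.
Qed.

Lemma near_eq_cvg_to (T : Type) (R : realType) (F : set_system T)
    {FF : Filter F} (f g : T -> R) (l : R) :
  (\forall x \near F, g x = f x) -> f x @[x --> F] --> l ->
  g x @[x --> F] --> l.
Proof.
by move=> fg; apply: cvg_trans; apply: near_eq_cvg; apply: filterS fg.
Qed.

Lemma cvg_at_right_scale (R : realType) (y : R) (f : R -> R) (l : R) : 0 < y ->
  f r @[r --> 0^'+] --> l -> f (r * y) @[r --> 0^'+] --> l.
Proof.
move=> y0 /cvgrPdist_le fl; apply/cvgrPdist_le => e e0.
have [d /= d0 hd] := fl e e0.
exists (d / y) => /=; first by rewrite divr_gt0.
move=> r /=; rewrite sub0r normrN => rd r0; apply: hd; last by rewrite /= mulr_gt0.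
by rewrite /= sub0r normrN normrM (gtr0_norm y0) -ltr_pdivlMr.
Qed.

(** Chosen so that [1 + tilt a b t] is the quotient of the quadratic polynomials
    of the points [(a, 1)] and [(b, 1)]. *)
Definition tilt (R : realType) (a b t : R) : R := quad a 1 t / quad b 1 t - 1.

Lemma measurable_tilt (R : realType) (a b : R) : measurable_fun setT (tilt a b).
Proof.
apply: measurable_funB => //.
rewrite (_ : (fun t => _) = fun t => quad a 1 t * quad b 1 t `^ (- 1)).
  by apply: measurable_funM; [exact: measurable_quad|exact: measurable_quad_powR].
by apply/funext => t; rewrite powR_inv1// ltW// quad_gt0.
Qed.

Lemma tilt_itv (R : realType) (a b t : R) :
  ((1 + `|a - b|) ^+ 2)^-1 - 1 <= tilt a b t <= (1 + `|a - b|) ^+ 2 - 1.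
Proof.
have a0 := quad_gt0 a t (ltr01 : 0 < 1 :> R).
have b0 := quad_gt0 b t (ltr01 : 0 < 1 :> R).
set K := (1 + `|a - b|) ^+ 2.
have K0 : 0 < K by rewrite exprn_gt0// ltr_pwDl.
have ab : quad b 1 t <= K * quad a 1 t.
  by apply: quad_le => //; rewrite mulr1.
have ba : quad a 1 t <= K * quad b 1 t.
  by rewrite /K distrC; apply: quad_le => //; rewrite mulr1.
rewrite /tilt !lerD2r ler_pdivrMr// ba andbT ler_pdivlMr//.
by rewrite ler_pdivrMl.
Qed.

(** [(1 - h) * quad b 1 t + h * quad a 1 t] is a monic positive quadratic
    polynomial, hence again the [quad] of a point; as [h] varies, that point
    describes the hyperbolic geodesic from [(b, 1)] to [(a, 1)]. *)
Lemma quad_pencil (R : realType) (a b h y t : R) :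
  y ^+ 2 = 1 + h * (1 - h) * (a - b) ^+ 2 ->
  quad (b + h * (a - b)) y t = quad b 1 t * (1 + h * tilt a b t).
Proof.
move=> yE; have b0 := quad_gt0 b t (ltr01 : 0 < 1 :> R).
have -> : quad b 1 t * (1 + h * tilt a b t) =
    quad b 1 t + h * (quad a 1 t - quad b 1 t).
  by rewrite /tilt; field; rewrite gt_eqF.
by rewrite {1}/quad yE /quad; ring.
Qed.

(** With [G x y r] the integral of [quad x y `^ (- s)] against the image of
    [mu / r] under [fun t => (t - x0) / r], a radial limit [L] along the direction
    of [(x, y)] says that [G x y r] tends to [L] times the Lebesgue integral of
    [quad x y `^ (- s)]. Take the middle direction [b] of the sector. The geodesic
    from [(b, 1)] to [(a, 1)] starts inside the sector, where the limits are
    known, and [transfer_limit] carries them to the end point [(a, 1)]. *)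
Lemma all_directions (R : realType) (beta x0 L a1 a2 : R) (u : R * R -> R)
    (mu : {measure set (measurableTypeR R) -> \bar R}) :
  0 < beta -> boundary_measure beta u mu -> 0 < c_ beta -> 0 <= L -> a1 < a2 ->
  (forall tau, a1 <= tau <= a2 ->
    radial_limit (fun p : R * R => p.2 `^ (beta - 2^-1) * u p) x0 tau L) ->
  forall a,
    radial_limit (fun p : R * R => p.2 `^ (beta - 2^-1) * u p) x0 a L.
Proof.
move=> beta0 hmu c0 L0 a12 lim a.
have [C C0 hu] := boundary_measure_real hmu c0.
set s := beta + 2^-1 in hu.
have s0 : 0 < s by rewrite addr_gt0.
pose G x y r := r `^ (2 * s - 1) *
  \int[mu]_t (quad (x0 + r * x) (r * y) t `^ (- s)).
have FE tau y r : 0 < y -> 0 < r ->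
    (r * y) `^ (beta - 2^-1) * u (x0 + tau * (r * y), r * y) =
    C * (r * y) `^ (2 * beta) + c_ beta * y `^ (2 * beta) * G (tau * y) y r.
  move=> y0 r0; have ry0 : 0 < r * y by rewrite mulr_gt0.
  have [_ ->] := hu (x0 + tau * (r * y)) (r * y) ry0.
  rewrite mulrA -powRD; last by rewrite (gt_eqF ry0) implybT.
  rewrite (_ : beta - 2^-1 + s = 2 * beta); last by rewrite /s; ring.
  rewrite /G (_ : 2 * s - 1 = 2 * beta); last by rewrite /s; field.
  rewrite (mulrCA tau) [in RHS]mulrCA mulrDr mulrC; congr (_ + _).
  by rewrite [in RHS]mulrA -[in RHS]mulrA powRM ?ltW//; ring.
have lim0 y : 0 < y -> C * (r * y) `^ (2 * beta) @[r --> 0^'+] --> (0 : R).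
  move=> y0; rewrite -[X in _ --> X](mulr0 C); apply: cvgM; first exact: cvg_cst.
  have b2 : 0 < 2 * beta by rewrite mulr_gt0.
  exact: (cvg_at_right_scale y0 (powR_cvg0 b2)).
(* the remaining term [C * (r * y) `^ (2 * beta)] of [F] vanishes in the limit *)
have limG tau y : 0 < y ->
    radial_limit (fun p : R * R => p.2 `^ (beta - 2^-1) * u p) x0 tau L <->
    G (tau * y) y r @[r --> 0^'+] --> L * (y `^ (- (2 * beta)) / c_ beta).
  move=> y0; have yb := powR_gt0 (2 * beta) y0.
  have cy0 : c_ beta * y `^ (2 * beta) != 0 by rewrite gt_eqF// mulr_gt0.
  have -> : L * (y `^ (- (2 * beta)) / c_ beta) = (L - 0) / (c_ beta * y `^ (2 * beta)).
    by rewrite powRN subr0 invfM (mulrC (_^-1)).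
  split=> [/(cvg_at_right_scale y0) Flim|Glim].
    have H : ((r * y) `^ (beta - 2^-1) * u (x0 + tau * (r * y), r * y) -
        C * (r * y) `^ (2 * beta)) / (c_ beta * y `^ (2 * beta)) @[r --> 0^'+] -->
        (L - 0) / (c_ beta * y `^ (2 * beta)).
      by apply: cvgM; [exact: (cvgB Flim (lim0 y y0))|exact: cvg_cst].
    apply: near_eq_cvg_to H; near=> r.
    have r0 : 0 < r by near: r; exact: nbhs_right_gt.
    by rewrite FE// addrAC subrr add0r mulrAC divff// mul1r.
  have yV : 0 < y^-1 by rewrite invr_gt0.
  have C1 := lim0 1 ltr01; have G1 := cvg_at_right_scale yV Glim.
  have H : C * (r * 1) `^ (2 * beta) + c_ beta * y `^ (2 * beta) *
      G (tau * y) y (r / y) @[r --> 0^'+] --> L.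
    have -> : L = 0 + c_ beta * y `^ (2 * beta) *
        ((L - 0) / (c_ beta * y `^ (2 * beta))).
      by rewrite add0r mulrC divfK// subr0.
    by apply: (cvgD C1); apply: cvgM; [exact: cvg_cst|exact: G1].
  apply: near_eq_cvg_to H; near=> r.
  have r0 : 0 < r by near: r; exact: nbhs_right_gt.
  rewrite /=.
  have := FE tau y (r / y) y0 (divr_gt0 r0 y0).
  by rewrite divfK ?gt_eqF// mulr1.
pose b := (a1 + a2) / 2; pose D := `|a - b|.
have D0 : 0 <= D by exact: normr_ge0.
pose g := (a2 - a1) / 2.
have g0 : 0 < g by rewrite divr_gt0// subr_gt0.
pose Q := D + (`|a1| + `|a2|) * D ^+ 2 + 1.
have Q0 : 0 < Q.
  by rewrite ltr_wpDl// addr_ge0// mulr_ge0 ?sqr_ge0// addr_ge0.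
pose ht h := Num.sqrt (1 + h * (1 - h) * (a - b) ^+ 2).
have hpos h : 0 <= h <= 1 -> 1 <= 1 + h * (1 - h) * (a - b) ^+ 2.
  by move=> /andP[h0 h1]; rewrite lerDl mulr_ge0 ?sqr_ge0// mulr_ge0// subr_ge0.
have htE h : 0 <= h <= 1 -> ht h ^+ 2 = 1 + h * (1 - h) * (a - b) ^+ 2.
  by move=> /hpos h1; rewrite sqr_sqrtr// (le_trans ler01).
have ht1 h : 0 <= h <= 1 -> 1 <= ht h.
  by move=> /hpos h1; rewrite -sqrtr1 ler_wsqrtr.
have ht0 h : 0 <= h <= 1 -> 0 < ht h by move=> /ht1; exact: lt_le_trans.
pose bw (r t : R) := r^-1 * quad b 1 ((t - x0) / r) `^ (- s).
pose w (r t : R) := tilt a b ((t - x0) / r).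
pose bw' (t : R) := L * quad b 1 t `^ (- s).
pose K := (1 + D) ^+ 2 + 1.
have K0 : 1 < K by rewrite ltrDr exprn_gt0// ltr_pwDl.
have tiltK t : K^-1 - 1 <= tilt a b t <= K - 1.
  have Kgt : (1 + D) ^+ 2 <= K by rewrite lerDl.
  have K'0 : 0 < (1 + D) ^+ 2 by rewrite exprn_gt0// ltr_pwDl.
  have /andP[t1 t2] := tilt_itv a b t; rewrite -/D in t1 t2.
  apply/andP; split; last by rewrite (le_trans t2)// lerD2r.
  by apply: le_trans t1; rewrite lerD2r lef_pV2 ?posrE// (lt_le_trans _ Kgt).
have pencil h t : 0 <= h <= 1 ->
    quad b 1 t `^ (- s) * (1 + h * tilt a b t) `^ (- s) =
    quad (b + h * (a - b)) (ht h) t `^ (- s).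
  move=> h01; have /andP[h0 h1] := h01.
  have /andP[t1 _] := tiltK t.
  have KV : 0 < K^-1 by rewrite invr_gt0 (lt_trans ltr01).
  rewrite -powRM; first by rewrite -(quad_pencil t (htE h h01)).
    by rewrite ltW// quad_gt0.
  have t2 : -1 <= tilt a b t by lra.
  have : h * -1 <= h * tilt a b t by rewrite ler_wpM2l.
  by lra.
have wl : \forall r \near (0 : R)^'+, bounded_weight mu (K^-1 - 1) (K - 1) (bw r) (w r).
  near=> r; have r0 : 0 < r by near: r; exact: nbhs_right_gt.
  split.
  - by move=> t; rewrite mulr_ge0 ?invr_ge0 ?powR_ge0// ltW.
  - have -> : bw r = fun t => r `^ (2 * s - 1) *
        quad (x0 + r * b) (r * 1) t `^ (- s).
      by apply/funext => t; rewrite /bw quad_powR_scale.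
    by apply: integrable_scale; apply: (hu _ _ _).1; rewrite mulr1.
  - apply: (@measurableT_comp _ _ _ _ _ _ (tilt a b)); first exact: measurable_tilt.
    by apply: measurable_funM => //; exact: measurable_funB.
  - by move=> t; exact: tiltK.
have wl' : bounded_weight (@lebesgue_measure R) (K^-1 - 1) (K - 1) bw' (tilt a b).
  split.
  - by move=> t; rewrite mulr_ge0 ?powR_ge0.
  - apply: integrable_scale; apply/integrableP; split.
      by apply/measurable_EFinP; exact: measurable_quad_powR.
    under eq_integral do rewrite /= ger0_norm ?powR_ge0//.
    by rewrite lebesgue_quad ?ltry// gt_eqF.
  - exact: measurable_tilt.
  - exact: tiltK.
have key h : 0 <= h <= 1 ->
    \int[mu]_t (bw r t * (1 + h * w r t) `^ (- s)) @[r --> 0^'+] -->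
    \int[@lebesgue_measure R]_t (bw' t * (1 + h * tilt a b t) `^ (- s)) <->
    G (b + h * (a - b)) (ht h) r @[r --> 0^'+] -->
      L * (ht h `^ (- (2 * beta)) / c_ beta).
  move=> h01; have hy := ht0 h h01.
  have -> : \int[@lebesgue_measure R]_t (bw' t * (1 + h * tilt a b t) `^ (- s)) =
      L * (ht h `^ (- (2 * beta)) / c_ beta).
    under eq_Rintegral do rewrite /bw' -mulrA pencil//.
    rewrite RintegralZl//; last first.
      apply/integrableP; split.
        by apply/measurable_EFinP; exact: measurable_quad_powR.
      under eq_integral do rewrite /= ger0_norm ?powR_ge0//.
      by rewrite lebesgue_quad ?ltry// gt_eqF.
    by rewrite /Rintegral lebesgue_quad// gt_eqF.
  have E : \forall r \near (0 : R)^'+,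
      \int[mu]_t (bw r t * (1 + h * w r t) `^ (- s)) = G (b + h * (a - b)) (ht h) r.
    near=> r; have r0 : 0 < r by near: r; exact: nbhs_right_gt.
    under eq_Rintegral do rewrite /bw -mulrA pencil// quad_powR_scale//.
    rewrite RintegralZl//.
    by have [] := hu (x0 + r * (b + h * (a - b))) (r * ht h) (mulr_gt0 r0 hy).
  by split; apply: near_eq_cvg_to => //; apply: filterS E => r ->.
have h11 : 0 <= (1 : R) <= 1 by rewrite lexx ler01.
have ht11 : ht 1 = 1 by rewrite /ht subrr mulr0 mul0r addr0 sqrtr1.
apply/(limG a 1 ltr01).
have := key 1 h11; rewrite mul1r addrCA subrr addr0 ht11 mulr1 => -[+ _]; apply.
have h10 h : 0 <= h -> h < Num.min 1 (g / Q) -> 0 <= h <= 1.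
  by move=> h0; rewrite lt_min => /andP[/ltW h1 _]; rewrite h0.
rewrite (_ : (fun r => \int[mu]_t (bw r t * (1 + 1 * w r t) `^ (- s))) =
    (fun r => \int[mu]_t (bw r t * (1 + w r t) `^ (- s)))); last first.
  by apply/funext => r; apply: eq_Rintegral => t _; rewrite mul1r.
under eq_Rintegral do rewrite mul1r.
apply: (@transfer_limit _ _ _ _ _ _ _ _ _ _ (K^-1 - 1) (K - 1) s
  (Num.min 1 (g / Q))) => //.
- by rewrite lt_min ltr01 divr_gt0.
- by rewrite ltrBrDr addNr invr_gt0 (lt_trans ltr01).
- by rewrite ltrD2r (lt_trans _ K0)// invf_lt1// (lt_trans ltr01).
move=> h hh0 hh1; have h01 := h10 h hh0 hh1.
have hy := ht0 h h01; have hy1 := ht1 h h01.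
apply/(key h h01).
have -> : b + h * (a - b) = ((b + h * (a - b)) / ht h) * ht h by rewrite divfK// gt_eqF.
apply/limG => //; apply: lim.
(* for [h * Q <= g] the direction of the point of parameter [h] stays within [g]
   of [b], as its abscissa moves by [h * D] and its height by [h * D ^+ 2] *)
have hQ : h * Q <= g.
  by move: hh1; rewrite lt_min => /andP[_ /ltW]; rewrite ler_pdivlMr.
have hy2 : ht h - 1 <= h * D ^+ 2.
  have : ht h ^+ 2 <= 1 + h * D ^+ 2.
    rewrite htE// lerD2l /D real_normK ?num_real//.
    by rewrite ler_wpM2r ?sqr_ge0// ler_piMr// gerBl.
  have : ht h <= ht h ^+ 2 by rewrite expr2 ler_peMl// ltW.
  by lra.
have hb : `|h * (a - b)| <= h * D by rewrite normrM (ger0_norm hh0).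
move: hb; rewrite ler_norml => /andP[hb1 hb2].
have ea1 : `|a1| * (ht h - 1) <= `|a1| * (h * D ^+ 2) by rewrite ler_wpM2l.
have ea2 : `|a2| * (ht h - 1) <= `|a2| * (h * D ^+ 2) by rewrite ler_wpM2l.
have hm : 0 <= ht h - 1 by rewrite subr_ge0.
have f1 : a1 * (ht h - 1) <= `|a1| * (ht h - 1) by rewrite ler_wpM2r// ler_norm.
have f2 : - (`|a2| * (ht h - 1)) <= a2 * (ht h - 1).
  by rewrite -mulNr ler_wpM2r// lerNl -normrN ler_norm.
have p1 : 0 <= `|a1| * (h * D ^+ 2) by rewrite mulr_ge0// mulr_ge0// sqr_ge0.
have p2 : 0 <= `|a2| * (h * D ^+ 2) by rewrite mulr_ge0// mulr_ge0// sqr_ge0.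
have hQE : h * Q = h * D + `|a1| * (h * D ^+ 2) + `|a2| * (h * D ^+ 2) + h.
  by rewrite /Q; ring.
rewrite ler_pdivlMr// ler_pdivrMr//; rewrite hQE /g in hQ.
by rewrite /b in hb1 hb2 *; apply/andP; split; lra.
Unshelve. all: by end_near. Qed.

(** * Non-tangential limits *)

(** By the Harnack inequality, [F] is near [L] not only along a ray but along all
    rays of nearby direction, and the directions in a cone form a compact set. *)
Lemma nontangential_of_radial (R : realType) (beta x0 L : R) (k : R -> R)
    (u : R * R -> R) : positive_on_half_plane u -> 0 <= L ->
  k 0 = 1 -> {for 0, continuous k} ->
  (forall eta x x' y, 0 <= eta -> 0 < y -> `|x - x'| <= eta * y ->
    u (x, y) <= k eta * u (x', y)) ->
  (forall a,
    radial_limit (fun p : R * R => p.2 `^ (beta - 2^-1) * u p) x0 a L) ->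
  nontangential_limit (fun p : R * R => p.2 `^ (beta - 2^-1) * u p) x0 L.
Proof.
move=> upos L0 k0 kc har lim alpha alpha0 e e0.
pose F (p : R * R) := p.2 `^ (beta - 2^-1) * u p.
have q0 : 0 < e / (4 * (L + e)) by rewrite divr_gt0// mulr_gt0// ltr_wpDl.
have [eta eta0 keta] : exists2 eta, 0 < eta & (k eta - 1) * (L + e) <= e / 4.
  move/cvgrPdist_le : kc => /(_ _ q0) [d /= d0 hd].
  exists (d / 2); first by rewrite divr_gt0.
  have hd2 : `|k 0 - k (d / 2)| <= e / (4 * (L + e)).
    by apply: hd; rewrite /= sub0r normrN gtr0_norm ?divr_gt0//; lra.
  move: hd2; rewrite k0 ler_distlC => /andP[_ h].
  rewrite -ler_pdivlMr ?ltr_wpDl// -mulrA -invfM lerBlDr addrC.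
  exact: h.
have k1 : 1 <= k eta.
  have := har eta x0 x0 1 (ltW eta0) ltr01.
  rewrite subrr normr0 mulr1 => /(_ (ltW eta0)).
  by rewrite ler_pMl//; apply: upos; exact: ltr01.
have cover : \forall y \near (0 : R)^'+,
    `[- alpha, alpha]%classic `<=` (fun tau => `|F (x0 + tau * y, y) - L| < e).
  have /compact_near_coveringP/(_ _ (0 : R)^'+
    (fun y tau => `|F (x0 + tau * y, y) - L| < e) _) :=
    @segment_compact R (- alpha) alpha.
  apply => tau _.
  have e4 : 0 < e / 4 by rewrite divr_gt0.
  move/cvgrPdist_le : (lim tau) => /(_ _ e4) near_tau.
  have near_tau' : \forall t \near tau, `|t - tau| <= eta.
    by exists eta => //= z /=; rewrite distrC; exact: ltW.
  near=> tau' y => /=.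
  have y0 : 0 < y by near: y; exact: nbhs_right_gt.
  have hy : `|L - F (x0 + tau * y, y)| <= e / 4 by near: y.
  have ht : `|tau' - tau| <= eta by near: tau'.
  have py : 0 < y `^ (beta - 2^-1) by exact: powR_gt0.
  have h1 : F (x0 + tau * y, y) <= k eta * F (x0 + tau' * y, y).
    rewrite /F /= mulrCA ler_pM2l//; apply: har => //; first exact: ltW.
    rewrite opprD addrACA subrr add0r -mulrBl normrM (gtr0_norm y0) distrC.
    by rewrite ler_pM2r.
  have h2 : F (x0 + tau' * y, y) <= k eta * F (x0 + tau * y, y).
    rewrite /F /= mulrCA ler_pM2l//; apply: har => //; first exact: ltW.
    rewrite opprD addrACA subrr add0r -mulrBl normrM (gtr0_norm y0).
    by rewrite ler_pM2r.
  have F0 : 0 <= F (x0 + tau * y, y) by rewrite mulr_ge0 ?powR_ge0// ltW// upos.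
  have F0' : 0 <= F (x0 + tau' * y, y) by rewrite mulr_ge0 ?powR_ge0// ltW// upos.
  move: (F (x0 + tau * y, y)) (F (x0 + tau' * y, y)) hy h1 h2 F0 F0' => v v'.
  rewrite ler_distlC => /andP[v1 v2] h1 h2 v0 v0'.
  have c1 : (k eta - 1) * v <= (k eta - 1) * (L + e).
    by rewrite ler_wpM2l ?subr_ge0//; lra.
  have v'L : v' <= L + e by lra.
  have c2 : (k eta - 1) * v' <= (k eta - 1) * (L + e).
    by rewrite ler_wpM2l ?subr_ge0//; lra.
  by rewrite ltr_distl; apply/andP; split; lra.
near=> y => x xa.
have y0 : 0 < y by near: y; exact: nbhs_right_gt.
have -> : x = x0 + ((x - x0) / y) * y by rewrite divfK ?gt_eqF// addrC subrK.
have cy : `[- alpha, alpha]%classic `<=` (fun tau => `|F (x0 + tau * y, y) - L| < e).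
  by near: y.
apply: cy; rewrite /= in_itv/= -ler_norml normrM normfV (gtr0_norm y0).
by rewrite ler_pdivrMr// ltW.
Unshelve. all: by end_near. Qed.

Theorem theorem5p1 (R : realType) (beta : R) (u : R * R -> R)
    (mu : {measure set (measurableTypeR R) -> \bar R}) (x0 L : R)
    (hbeta : 0 < beta)
    (heig : eigenfunction (beta ^+ 2 - 4^-1) u)
    (hpos : positive_on_half_plane u)
    (hmu : boundary_measure beta u mu)
    (hL : 0 <= L)
    (alpha1 alpha2 : R)
    (hrays : ray x0 alpha1 <> ray x0 alpha2)
    (hlim1 : radial_limit
       (fun p : R * R => p.2 `^ (beta - 2^-1) * u p) x0 alpha1 L)
    (hlim2 : radial_limit
       (fun p : R * R => p.2 `^ (beta - 2^-1) * u p) x0 alpha2 L) :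
  nontangential_limit (fun p : R * R => p.2 `^ (beta - 2^-1) * u p) x0 L.
Proof.
wlog a12 : alpha1 alpha2 hrays hlim1 hlim2 / alpha1 < alpha2.
  move=> wl; have [a12|a21|aE] := ltgtP alpha1 alpha2; first exact: wl a12.
    by apply: wl a21 => // rE; apply: hrays.
  by case: hrays; rewrite aE.
pose k (eta : R) := ((1 + eta) ^+ 2) `^ (beta + 2^-1).
have har eta x x' y : 0 <= eta -> 0 < y -> `|x - x'| <= eta * y ->
    u (x, y) <= k eta * u (x', y).
  by move=> eta0 y0; exact: harnack hmu y0 eta0.
have sector := @sector_limit R beta x0 L (k (alpha2 - alpha1)) alpha1 alpha2 u
  hbeta heig hpos hL a12 (powR_ge0 _ _).
have dir a : radial_limit (fun p : R * R => p.2 `^ (beta - 2^-1) * u p) x0 a L.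
  have := c_ge0 beta; rewrite le_eqVlt => /predU1P[c0|c0].
    (* here [u] depends on the height alone, and all directions are alike *)
    have [C _ hu] := hmu.
    have uE x y : 0 < y -> u (x, y) = C * y `^ (beta + 2^-1).
      by move=> y0; have := hu x y y0; rewrite -c0 mul0e adde0 => -[].
    apply: near_eq_cvg_to hlim1; near=> y.
    have y0 : 0 < y by near: y; exact: nbhs_right_gt.
    by rewrite !uE.
  apply: (all_directions hbeta hmu c0 hL a12) => tau htau.
  apply: sector => // t y ht y0; apply: har => //; first by rewrite subr_ge0 ltW.
  rewrite opprD addrACA subrr add0r -mulrBl normrM (gtr0_norm y0) ler_pM2r//.
  by case/andP: ht => t1 t2; rewrite ger0_norm ?subr_ge0// lerD2r.
apply: (nontangential_of_radial hpos hL _ _ har dir).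
  by rewrite /k addr0 expr1n powR1.
have c1 : {for 0, continuous (fun eta : R => 1 + eta)}.
  by apply: cvgD; [exact: cvg_cst|exact: cvg_id].
apply: (@continuous_comp _ _ _ (fun eta : R => (1 + eta) ^+ 2)
  (fun z : R => z `^ (beta + 2^-1))); first exact: (cvgM c1 c1).
apply/differentiable_continuous/derivable1_diffP/ex_derive/is_derive1_powR.
by rewrite addr0 expr1n.
Unshelve. all: by end_near. Qed.
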